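(* Let $G$ be a countable group and $\mu$ a probability measure on $G$ with finite entropy $H(\mu)<\infty$. Let $\tau$ be a Markov stopping time for the random walk $(G,\mu)$ with finite expectation $\mathbf{E}(\tau)$. Then $H(\mu_\tau)$ is also finite, and $$h(\mu_\tau)=\mathbf{E}(\tau)\,h(\mu).$$
   Context: Entropy. For a probability measure $\rho$ on the countable group $G$, $H(\rho)=-\sum_{g\in G}\rho(g)\log\rho(g)$ (with $0\log 0=0$), and the asymptotic entropy is $h(\rho)=\lim_{n\to\infty}\frac1n H(\rho^{*n})$, where $\rho^{*n}$ is the $n$-fold convolution power (the limit exists by subadditivity). Random walk. The random walk $(G,\mu)$ issued from the identity $e$ has positions $x_0=e$, $x_n=h_1h_2\cdots h_n$, where the increments $h_1,h_2,\dots$ are independent and identically $\mu$-distributed. $\mathbf{P}$ is the law of the sample path $\boldsymbol{x}=(e,x_1,x_2,\dots)$ and $\mathbf{E}$ the corresponding expectation. Markov stopping time. A Markov stopping time is a measurable function $\tau$ on the space of sample paths with values in $\mathbb{N}=\{1,2,\dots\}$, finite almost everywhere, such that for every $s\in\mathbb{N}$ the event $\{\tau=s\}$ belongs to the $\sigma$-algebra generated by $x_0,\dots,x_s$. The transformed measure $\mu_\tau$ is the distribution of $x_\tau$: $\mu_\tau(g)=\mathbf{P}\{\boldsymbol{x}: x_\tau=g\}$ for $g\in G$. *)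

(* Defs.v *)
From HB Require Import structures.
From mathcomp Require Import all_boot all_order all_algebra finmap.
From mathcomp Require Import all_classical all_reals all_analysis.

Set Implicit Arguments.
Unset Strict Implicit.
Unset Printing Implicit Defensive.

Import Order.TTheory GRing.Theory Num.Theory.

Local Open Scope classical_set_scope.
Local Open Scope ring_scope.
Local Open Scope ereal_scope.

(* A group with its discrete sigma-algebra, so that [probability (discrete G) R]
   is the type of probability measures on G. *)
Definition discrete (G : groupType) : Type := G.

HB.instance Definition _ (G : groupType) := Choice.on (discrete G).
HB.instance Definition _ (G : groupType) :=
  isPointed.Build (discrete G) (1%g : G).
HB.instance Definition _ (G : groupType) :=
  @isMeasurable.Build default_measure_display (discrete G)
    discrete_measurable discrete_measurable0
    discrete_measurableC discrete_measurableU.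

Definition paths (G : groupType) : Type := nat -> G.

(* The sigma-algebra on sample paths generated by the positions x_n, n in N. *)
Definition sigma_positions (G : groupType) (N : set nat) : set (set (paths G)) :=
  <<s \bigcup_(n in N)
        preimage_set_system setT (fun x : paths G => x n) discrete_measurable >>.

Section path_space.
Variable G : groupType.

Let positions0 : sigma_positions setT (set0 : set (paths G)).
Proof. exact: sigma_algebra0. Qed.

Let positionsC (A : set (paths G)) :
  sigma_positions setT A -> sigma_positions setT (~` A).
Proof. by move=> mA; rewrite -setTD; exact: sigma_algebraCD. Qed.

Let positionsU (F : (set (paths G))^nat) :
  (forall i, sigma_positions setT (F i)) ->
  sigma_positions setT (\bigcup_i F i).
Proof. exact: sigma_algebra_bigcup. Qed.

HB.instance Definition _ := Choice.on (paths G).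
HB.instance Definition _ := isPointed.Build (paths G) (fun _ => 1%g : G).
HB.instance Definition _ :=
  @isMeasurable.Build default_measure_display (paths G)
    (sigma_positions setT) positions0 positionsC positionsU.

End path_space.

(* The n-th increment is h_{n+1} = x_n^{-1} x_{n+1}; a path with x_0 = e then
   satisfies x_n = h_1 h_2 ... h_n. *)
Definition increment (G : groupType) (n : nat) (x : paths G) : G :=
  ((x n)^-1 * x n.+1)%g.

Definition mutually_independent (R : realType) d (Omega : measurableType d)
    (P : probability Omega R) (T : Type) (X : nat -> Omega -> T) : Prop :=
  forall (J : {fset nat}) (A : nat -> set T),
    P (\bigcap_(i in [set` J]) X i @^-1` A i) =
    \prod_(i <- J) P (X i @^-1` A i).

(* P is the law of the sample path of the random walk (G, mu) issued from e.
   Since the increments determine a path with x_0 = e, these conditions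
   determine P. *)
Definition random_walk_law (R : realType) (G : groupType)
    (mu : probability (discrete G) R) (P : probability (paths G) R) : Prop :=
  [/\ P [set x | x 0%N = 1%g] = 1,
      forall n (A : set G), P (increment n @^-1` A) = mu A
    & mutually_independent P (@increment G)].

(* [None] is the value of a stopping time that never occurs. *)
Definition markov_stopping_time (R : realType) (G : groupType)
    (P : probability (paths G) R) (tau : paths G -> option nat) : Prop :=
  [/\ forall A : set (option nat), measurable (tau @^-1` A),
      forall x s, tau x = Some s -> (0 < s)%N,
      {ae P, forall x, tau x <> None}
    & forall s, (0 < s)%N ->
        sigma_positions `I_s.+1 [set x | tau x = Some s]].

Definition time_expectation (R : realType) (G : groupType)
    (P : probability (paths G) R) (tau : paths G -> option nat) : \bar R :=
  \int[P]_x (if tau x is Some s then s%:R%:E else +oo).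

Definition mass (R : realType) (G : groupType)
    (mu : probability (discrete G) R) (g : G) : R :=
  fine (mu [set g]).

(* The transformed measure mu_tau, given by its values on points. *)
Definition stopped_mass (R : realType) (G : groupType)
    (P : probability (paths G) R) (tau : paths G -> option nat) (g : G) : R :=
  fine (P [set x | exists2 s, tau x = Some s & x s = g]).

(* The convention 0 log 0 = 0 holds because of the factor [rho g]. *)
Definition entropy (R : realType) (G : groupType) (rho : G -> R) : \bar R :=
  \esum_(g in [set: G]) (- (rho g * ln (rho g)))%:E.

Definition convolution (R : realType) (G : groupType) (rho sigma : G -> R)
    (g : G) : R :=
  fine (\esum_(h in [set: G]) (rho h * sigma (h^-1 * g)%g)%:E).

Definition convolution_power (R : realType) (G : groupType) (rho : G -> R)
    (n : nat) : G -> R :=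
  iter n (convolution rho) (fun g => (g == 1%g)%:R%R).

Definition asymptotic_entropy (R : realType) (G : groupType) (rho : G -> R) :
    \bar R :=
  limn (fun n => (n%:R^-1)%:E * entropy (convolution_power rho n)).

(* Main.v *)
(* Write N_n for the n-th iterate of tau along the walk, so that x_(N_n) is the
   random walk driven by mu_tau, and put l := E(tau).

   Gibbs' inequality bounds the entropy of a random element Z by the mean of
   - ln q(Z) for any sub-probability q.  Taking for q the convolution of the law
   of Y with a sub-probability q', one gets
     H(X) <= H(Y) + E(- ln q'(Y^-1 X))
   without any independence.  With q' the symmetrisation of
   sum_k 2^-(k+1) mu^{*k}, the displacement between times N and m costs at most
   2 ln 2 + sum (ln 2 - ln mu(h_i)), the sum running over the increments h_i
   between the two times; by the Markov property (Wald's identity) this has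
   mean 2 ln 2 + (ln 2 + H(mu)) E|N - m|.  Hence
     |H(x_(N_n)) - H(x_m)| <= 2 ln 2 + (ln 2 + H(mu)) E|N_n - m|.
   With n = 1 this shows that H(mu_tau) is finite.  With m the integer part of
   n l, the right-hand side is o(n): for psi_K(x) = sqrt(K^2 + x^2) one has
   E psi_K(N_n - n l) <= K + n c_K where c_K = E min((tau - l)^2/2K, 2|tau - l|)
   tends to 0 as K grows.  Dividing by n and letting n grow gives
   h(mu_tau) = l h(mu). *)
Require Import Defs.
From mathcomp Require Import all_boot all_order all_algebra finmap.
From mathcomp Require Import all_classical all_reals all_analysis.
From mathcomp Require Import measurable_realfun ring lra.

Set Implicit Arguments.
Unset Strict Implicit.
Unset Printing Implicit Defensive.
Import Order.TTheory GRing.Theory Num.Theory.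
Import numFieldNormedType.Exports.

Local Open Scope classical_set_scope.
Local Open Scope ring_scope.
Local Open Scope ereal_scope.

(** * Sums and integrals over the fibres of a countable-valued map *)

Section esum_complements.
Context {R : realType}.

Lemma esumZl (I : choiceType) (D : set I) (k : R) (a : I -> \bar R) :
  (0 <= k)%R -> (forall i, 0 <= a i) ->
  \esum_(i in D) (k%:E * a i) = k%:E * \esum_(i in D) a i.
Proof.
move=> k0 a0.
have le_Zl (c : R) (b : I -> \bar R) : (0 <= c)%R -> (forall i, 0 <= b i) ->
    \esum_(i in D) (c%:E * b i) <= c%:E * \esum_(i in D) b i.
  move=> c0 b0; apply: ge_ereal_sup => _ [F [finF FD] <-].
  rewrite -ge0_mule_fsumr// lee_wpmul2l ?lee_fin//.
  by apply: ereal_sup_ubound; exists F.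
apply/eqP; rewrite eq_le le_Zl//=.
have [->|kn0] := eqVneq k 0%R.
  by rewrite mul0e; apply: esum_ge0 => i _; rewrite mul0e.
have kp : (0 < k)%R by rewrite lt_neqAle eq_sym kn0.
(* The reverse inequality is [le_Zl] again, for the factor [k^-1] and the family [k * a]. *)
rewrite -lee_pdivlMl//; apply: le_trans (le_Zl _ _ _ _).
- by apply: le_esum => i _; rewrite muleA -EFinM mulVf// mul1e.
- by rewrite invr_ge0.
- by move=> i; rewrite mule_ge0 ?lee_fin.
Qed.

Lemma exchange_esum (I J : choiceType) (D : set I) (E : set J)
    (a : I -> J -> \bar R) : (forall i j, 0 <= a i j) ->
  \esum_(i in D) \esum_(j in E) a i j = \esum_(j in E) \esum_(i in D) a i j.
Proof.
move=> a0; rewrite !esum_esum//.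
rewrite (reindex_esum (D `*` E) _ (fun x => (x.2, x.1)))//; split=> //=.
- by move=> [i j] [/=].
- by move=> [i1 i2] [j1 j2] /= _ _ [-> ->].
- by move=> [i j] [/= Ei Dj]; exists (j, i).
Qed.

Lemma le_esum_term (I : choiceType) (a : I -> \bar R) (i : I) :
  (forall j, 0 <= a j) -> a i <= \esum_(j in [set: I]) a j.
Proof.
move=> a0; apply: esum_ge; exists [set i]; last by rewrite fsbig_set1.
by split=> //; exact: finite_set1.
Qed.

(** An injection of [I] into the integers turns the fibres of [Z] into a disjoint sequence covering
    the space, with empty sets at integers that code no element; countable additivity then applies.
    Conditioning on a discrete variable is done below in this form. *)
Lemma ge0_integral_esum_fibers d (T : measurableType d)
    (m : {measure set T -> \bar R}) (I : choiceType) (Z : T -> I)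
    (f : T -> \bar R) : countable [set: I] ->
  (forall i, measurable (Z @^-1` [set i])) -> measurable_fun setT f ->
  (forall x, 0 <= f x) ->
  \int[m]_x f x = \esum_(i in [set: I]) \int[m]_(x in Z @^-1` [set i]) f x.
Proof.
move=> /countable_injP[e einj'] mZ mf f0.
have einj : injective e by move=> i j; apply: einj'; rewrite inE.
pose F n := (e \o Z) @^-1` [set n].
have eF i : F (e i) = Z @^-1` [set i].
  by apply/seteqP; split=> x; [exact: einj|rewrite /F /= => ->].
have F0 n : ~ (e @` [set: I]) n -> F n = set0.
  move=> en; apply/seteqP; split => // x /= exn; apply: en.
  by exists (Z x).
have mF n : measurable (F n).
  have [[i _ <-]|/F0 ->] := pselect ((e @` [set: I]) n); last exact: measurable0.
  by rewrite eF.
have UF : \bigcup_k F k = setT.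
  by apply/seteqP; split => // x _; exists (e (Z x)).
rewrite -UF ge0_integral_bigcup//; last 2 first.
- by rewrite UF.
- by move=> i j _ _ [x [<- <-]].
rewrite nneseries_esumT; last by move=> n; exact: integral_ge0.
under [RHS]eq_esum do rewrite -eF.
rewrite -(esum_image _ e (fun n => \int[m]_(x in F n) f x)); last first.
  by move=> i j _ _; exact: einj.
rewrite [RHS]esum_mkcond; apply: eq_esum => n _; case: ifPn => //.
by rewrite notin_setE => /F0 ->; rewrite integral_set0.
Qed.

Lemma measure_esum_fibers d (T : measurableType d)
    (m : {measure set T -> \bar R}) (I : choiceType) (Z : T -> I)
    (A : set T) : countable [set: I] ->
  (forall i, measurable (Z @^-1` [set i])) -> measurable A ->
  m A = \esum_(i in [set: I]) m (A `&` Z @^-1` [set i]).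
Proof.
move=> cI mZ mA; transitivity (\int[m]_x (\1_A x)%:E); first by rewrite integral_indic// setIT.
rewrite (ge0_integral_esum_fibers m cI mZ); last 2 first.
- by apply/measurable_EFinP; exact: measurable_indic.
- by move=> x; rewrite lee_fin.
by apply: eq_esum => i _; rewrite integral_indic.
Qed.

Lemma eq_measure_off_null d (T : measurableType d)
    (m : {measure set T -> \bar R}) (A B N : set T) :
  measurable A -> measurable B -> measurable N -> m N = 0 ->
  (forall x, ~ N x -> A x <-> B x) -> m A = m B.
Proof.
have le_m (C D : set T) : measurable C -> measurable D -> measurable N ->
    m N = 0 -> (forall x, ~ N x -> C x -> D x) -> m C <= m D.
  move=> mC mD mN N0 CD; rewrite -(measureU0 mD mN N0).
  apply: le_measure; rewrite ?inE//; first exact: measurableU.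
  by move=> x Cx; have [Nx|/CD/(_ Cx) Dx] := pselect (N x); [right|left].
move=> mA mB mN N0 AB; apply/eqP; rewrite eq_le !le_m// => x nNx /AB; exact.
Qed.

End esum_complements.

(** * Events determined by an initial segment of the path *)

Section path_space.
Context {G : groupType}.
Implicit Types (x y : paths G) (A B : set (paths G)).

(** A pointwise substitute for membership in the sigma-algebra of x_0, ..., x_n: every event of that
    sigma-algebra has this property, which is easy to transport along maps of paths. *)
Definition determined (n : nat) A :=
  forall x y, (forall i, (i <= n)%N -> x i = y i) -> A x -> A y.

(** Translating by [(x n)^-1] makes the future after time [n] start again at the identity. *)
Definition shift (n : nat) x : paths G := fun k => ((x n)^-1 * x (n + k)%N)%g.

(** Forces the increment at [n] to be [g]. Positions after [n.+1] are left alone, since only events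
    determined at [n.+1] are pulled back along this map. *)
Definition extend (n : nat) (g : G) x : paths G :=
  fun i => if i == n.+1 then (x n * g)%g else x i.

Lemma determinedC n A : determined n A -> determined n (~` A).
Proof. by move=> dA x y xy nAx /dA Ay; apply/nAx/Ay => i /xy. Qed.

Lemma determined_bigcup n I (D : set I) (F : I -> set (paths G)) :
  (forall i, D i -> determined n (F i)) -> determined n (\bigcup_(i in D) F i).
Proof. by move=> dF x y xy [i Di Fix]; exists i => //; apply: dF xy Fix. Qed.

Lemma determinedI n A B :
  determined n A -> determined n B -> determined n (A `&` B).
Proof. by move=> dA dB x y xy [/(dA _ _ xy) ? /(dB _ _ xy)]. Qed.

Lemma determined_le n p A : (n <= p)%N -> determined n A -> determined p A.
Proof. by move=> np dA x y xy; apply: dA => i /leq_trans /(_ np) /xy. Qed.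

Lemma determined_position n (B : set G) : determined n [set x | B (x n)].
Proof. by move=> x y xy /=; rewrite xy. Qed.

Lemma determined_shift n p A :
  determined p A -> determined (n + p) (shift n @^-1` A).
Proof.
move=> dA x y xy; apply: dA => i ip.
by rewrite /shift !xy// ?leq_addr// leq_add2l.
Qed.

Lemma determined_extend n g A :
  determined n.+1 A -> determined n (extend n g @^-1` A).
Proof.
move=> dA x y xy; apply: dA => i; rewrite /extend.
case: eqVneq => [_ _|ni]; first by rewrite xy.
by rewrite leq_eqVlt (negPf ni)/= ltnS => /xy.
Qed.

(** Where the increment at [n] is [g], extending by [g] does not change the path. An event
    determined at [n.+1] is thus traded for one determined at [n], which drives the inductions on
    time below. *)
Lemma extend_increment n g A : determined n.+1 A ->
  A `&` increment n @^-1` [set g] =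
  extend n g @^-1` A `&` increment n @^-1` [set g].
Proof.
move=> dA; apply/seteqP; split => x [Ax xg]; split => //; move: Ax;
  apply: dA => i _; rewrite /extend; case: eqP => // ->;
  by rewrite -xg /increment mulgA mulgV mul1g.
Qed.

Lemma sigma_positions_determined n A :
  sigma_positions `I_n.+1 A -> determined n A.
Proof.
apply: smallest_sub; first split.
- by [].
- by move=> B dB; rewrite setTD; exact: determinedC.
- by move=> F dF; apply: determined_bigcup => i _; exact: dF.
move=> _ [k /= kn [B _ <-]] x y xy [_ Bx]; split => //=.
by rewrite /preimage/= -xy.
Qed.

Lemma measurable_position n (B : set G) : measurable [set x : paths G | B (x n)].
Proof.
by apply: sub_sigma_algebra; exists n => //; exists B => //; rewrite setTI.
Qed.

(** * Measurability of determined events over a countable group *)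

Section countable_group.
Hypothesis countableG : countable [set: G].

Lemma measurable_increment n (B : set G) :
  measurable (increment n @^-1` B : set (paths G)).
Proof.
rewrite [X in measurable X](_ : _ = \bigcup_(g : G)
    ([set x | x n = g] `&` [set x | B (g^-1 * x n.+1)%g])); last first.
  by apply/seteqP; split => [x Bx|x [g _ [<-]]//]; exists (x n).
apply: countable_bigcupT_measurable => // g; apply: measurableI.
  exact: (measurable_position n [set g]).
exact: (measurable_position n.+1 [set h | B (g^-1 * h)%g]).
Qed.

(** Induction on [n], slicing [A] along the value of its last increment; countability of [G] makes
    the union of slices countable. *)
Lemma measurable_determined n A : determined n A -> measurable A.
Proof.
elim: n A => [|n IH] A dA.
  rewrite [X in measurable X](_ : _ = \bigcup_(g : G)
    ([set x | x 0%N = g] `&` [set x | A (fun=> g)])); last first.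
    apply/seteqP; split => [x Ax|x [g _ [xg Ag]]].
      exists (x 0%N) => //; split => //.
      by apply: dA Ax => i; rewrite leqn0 => /eqP ->.
    by apply: dA Ag => i; rewrite leqn0 => /eqP ->.
  apply: countable_bigcupT_measurable => // g; apply: measurableI.
    exact: (measurable_position 0 [set g]).
  have [Ag|nAg] := pselect (A (fun=> g)).
    by rewrite (_ : [set _ | _] = setT)//; apply/seteqP; split.
  by rewrite (_ : [set _ | _] = set0)//; apply/seteqP; split.
rewrite [X in measurable X](_ : _ = \bigcup_(g : G)
    (extend n g @^-1` A `&` increment n @^-1` [set g])); last first.
  apply/seteqP; split => [x Ax|x [g _]].
    exists (increment n x) => //; rewrite -extend_increment//.
  by rewrite -extend_increment// => -[].
apply: countable_bigcupT_measurable => // g; apply: measurableI.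
  by apply: IH; exact: determined_extend.
exact: measurable_increment.
Qed.

Lemma measurable_shift n : measurable_fun setT (shift n).
Proof.
apply: (@measurability _ _ _ _ _ _ (\bigcup_(n in setT)
        preimage_set_system setT (fun x : paths G => x n) discrete_measurable)).
  by [].
move=> _ [_ [k _ [B _ <-]] <-]; rewrite !setTI.
apply: (@measurable_determined (n + k)); apply: determined_shift.
exact: determined_position.
Qed.

(** Determined events are stable under intersection, so this is the generating pi-system needed for
    uniqueness of measures. *)
Lemma measurable_paths_determined :
  measurable = <<s [set A | exists n, determined n A] >>.
Proof.
apply/seteqP; split => A.
  apply: smallest_sub; first exact: smallest_sigma_algebra.
  move=> _ [k _ [B _ <-]]; apply: sub_sigma_algebra; exists k.
  by rewrite setTI; exact: determined_position.
apply: smallest_sub; first exact: sigma_algebra_measurable.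
by move=> B [n]; exact: measurable_determined.
Qed.

End countable_group.
End path_space.

(** * The Markov property *)

Section markov_property.
Context {R : realType} {G : groupType}.
Hypothesis countableG : countable [set: G].
Variables (mu : probability (discrete G) R) (P : probability (paths G) R).
Hypothesis P_law : random_walk_law mu P.
Implicit Types (A B : set (paths G)).

Let mincr n (B : set G) : measurable (increment n @^-1` B : set (paths G)).
Proof. exact: measurable_increment. Qed.

Let mdet n A : determined n A -> measurable A.
Proof. exact: measurable_determined. Qed.

Lemma random_walk_start_ae A : measurable A ->
  (forall x, x 0%N = 1%g -> A x) -> P A = 1.
Proof.
move=> mA hA; have [P0 _ _] := P_law.
apply/eqP; rewrite eq_le probability_le1//= -[leLHS]P0.
by apply: le_measure; rewrite ?inE//; exact: (measurable_position 0 [set 1%g]).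
Qed.

(** The walk starts almost surely at the identity, so [A] has probability 0 or 1. *)
Lemma determined0_independent A B : determined 0 A -> measurable B ->
  P (A `&` B) = P A * P B.
Proof.
move=> dA mB; have mA := mdet dA.
have agree x : x 0%N = 1%g -> A x <-> A (fun=> 1%g).
  by move=> x0; split; apply: dA => i; rewrite leqn0 => /eqP ->.
have [A1|nA1] := pselect (A (fun=> 1%g)).
  have PA : P A = 1 by apply: random_walk_start_ae => // x /agree ->.
  have PCA : P (~` A) = 0.
    by rewrite probability_setC// PA subee.
  rewrite PA mul1e [in RHS](_ : B = (A `&` B) `|` (~` A `&` B)); last first.
    by rewrite -setIUl setUv setTI.
  have mCA := measurableC mA.
  rewrite measureU0//; [exact: measurableI|exact: measurableI|].
  by apply: subset_measure0 PCA => //; exact: measurableI.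
have PCA : P (~` A) = 1.
  by apply: random_walk_start_ae => [|x /agree xA]; [exact: measurableC|rewrite /setC/= xA].
have PA : P A = 0.
  by rewrite -[A]setCK probability_setC ?PCA ?subee//; exact: measurableC.
by rewrite PA mul0e; apply: subset_measure0 PA => //; exact: measurableI.
Qed.

(** Induction on [n]: on the slice where the last increment is [g], the event [A] may be replaced by
    one determined a step earlier, and the condition on that increment joins the family indexed by
    [J]. Hence the statement for arbitrary finite [J]. *)
Lemma determined_independent n A (J : {fset nat}) (B : nat -> set G) :
  determined n A -> (forall i, i \in J -> (n <= i)%N) ->
  P (A `&` \bigcap_(i in [set` J]) increment i @^-1` B i) =
  P A * \prod_(i <- J) P (increment i @^-1` B i).
Proof.
elim: n A J B => [|n IH] A J B dA nJ.
  have [_ _ <-] := P_law; apply: determined0_independent => //.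
  by apply: fin_bigcap_measurable => // i _; exact: mincr.
set C := \bigcap_(i in _) _.
have mC : measurable C by apply: fin_bigcap_measurable => // i _; exact: mincr.
have mA := mdet dA.
have step g : P (A `&` C `&` increment n @^-1` [set g]) =
    P (A `&` increment n @^-1` [set g]) * \prod_(i <- J) P (increment i @^-1` B i).
  have nJn : n \notin J by apply/negP => /nJ; rewrite ltnn.
  have dE := determined_extend (g := g) dA.
  (* One family prescribing [g] at [n] and [B] on [J]; there is no clash because [J] lies strictly
     above [n]. *)
  pose B' i := if i == n then [set g] else B i.
  have BB' i : i \in J -> B' i = B i.
    by move=> iJ; rewrite /B'; case: eqP => // ni; rewrite -ni iJ in nJn.
  have B'n : B' n = [set g] by rewrite /B' eqxx.
  have prodB' : \prod_(i <- J) P (increment i @^-1` B i) =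
      \prod_(i <- J) P (increment i @^-1` B' i).
    by rewrite big_seq [RHS]big_seq; apply: eq_bigr => i /BB' ->.
  rewrite setIAC (extend_increment g dA) prodB'.
  have := IH _ [fset n]%fset B' dE.
  rewrite big_seq_fset1 set_fset1 bigcap_set1 B'n => ->; last first.
    by move=> i; rewrite inE => /eqP ->.
  have prodU : P (increment n @^-1` [set g]) *
        \prod_(i <- J) P (increment i @^-1` B' i) =
      \prod_(i <- (n |` J)%fset) P (increment i @^-1` B' i).
    by rewrite big_fsetU1//= B'n.
  rewrite -muleA prodU -IH//; last first.
    by move=> i; rewrite !inE => /predU1P[->//|/nJ/ltnW].
  congr (P _); rewrite -setIA; congr (_ `&` _).
  apply/seteqP; split => x.
    move=> [xg Cx] i /=; rewrite !inE => /predU1P[->|iJ].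
      by rewrite /B' eqxx.
    by rewrite BB'//; exact: Cx.
  move=> h; split; last by move=> i iJ /=; rewrite -BB'//; apply: h; rewrite /= !inE iJ orbT.
  have := h n; rewrite /= !inE eqxx /B' eqxx; exact.
have prodE : \prod_(i <- J) P (increment i @^-1` B i) \is a fin_num.
  by apply: prode_fin_num => i _; apply: fin_num_measure; exact: mincr.
have prod0 : 0 <= \prod_(i <- J) P (increment i @^-1` B i).
  by apply: prode_ge0 => i _.
rewrite (measure_esum_fibers P (Z := increment n) countableG)//; last first.
  exact: measurableI.
rewrite (eq_esum (fun g _ => step g)).
under eq_esum do rewrite muleC -(fineK prodE).
rewrite esumZl ?fine_ge0// fineK// muleC; congr (_ * _).
by rewrite -measure_esum_fibers// => i; exact: mincr.
Qed.

Lemma determined_increment_independent n A (B : set G) : determined n A ->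
  P (A `&` increment n @^-1` B) = P A * mu B.
Proof.
move=> dA; have := determined_independent (J := [fset n]%fset) (fun=> B) dA.
rewrite big_seq_fset1 set_fset1 bigcap_set1.
have [_ -> _] := P_law; apply => i; rewrite inE => /eqP ->//.
Qed.

(** Induction on [p], slicing [B] along its last increment: seen from the whole path this is the
    increment at [n + p], independent of everything determined at that time. For [p = 0] the shifted
    path starts at the identity, so the shifted event is full or empty. *)
Lemma markov_property_determined n p A B : determined n A -> determined p B ->
  P (A `&` shift n @^-1` B) = P A * P B.
Proof.
move=> dA; elim: p B => [|p IH] B dB.
  have shiftB x : B (shift n x) = B (fun=> 1%g).
    rewrite propeqE; split; apply: dB => i; rewrite leqn0 => /eqP ->;
    by rewrite /shift addn0 mulVg.
  have [B1|nB1] := pselect (B (fun=> 1%g)).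
    rewrite (_ : shift n @^-1` B = setT); last first.
      by apply/seteqP; split => // x _; rewrite /preimage/= shiftB.
    rewrite setIT (_ : P B = 1) ?mule1//; apply: random_walk_start_ae.
      exact: mdet dB.
    by move=> x x0; apply: dB B1 => i; rewrite leqn0 => /eqP ->.
  rewrite (_ : shift n @^-1` B = set0); last first.
    by apply/seteqP; split => // x; rewrite /preimage/= shiftB.
  rewrite setI0 measure0 (_ : P B = 0) ?mule0//.
  rewrite -[B]setCK probability_setC; last by apply: measurableC; exact: mdet dB.
  rewrite (_ : P (~` B) = 1) ?subee//; apply: random_walk_start_ae.
    by apply: measurableC; exact: mdet dB.
  move=> x x0 Bx; apply/nB1; apply: dB Bx => i; rewrite leqn0 => /eqP ->//.
have mfib q g : measurable (increment q @^-1` [set g] : set (paths G)).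
  exact: mincr.
have mB := mdet dB; have dA' := determinedI (determined_le (leq_addr p.+1 n) dA)
  (determined_shift (n := n) dB).
rewrite (measure_esum_fibers P (Z := increment (n + p)) countableG)//; last first.
  exact: mdet dA'.
have incr_shift x : increment (n + p) x = increment p (shift n x).
  by rewrite /increment /shift addnS invgM invgK mulgA mulgK.
have step g : P (A `&` shift n @^-1` B `&` increment (n + p) @^-1` [set g]) =
    P A * P (B `&` increment p @^-1` [set g]).
  have dE := determined_extend (g := g) dB.
  have incrE : increment (n + p) @^-1` [set g] =
      shift n @^-1` (increment p @^-1` [set g]).
    by apply/seteqP; split => x; rewrite /preimage/= incr_shift.
  rewrite -setIA incrE -preimage_setI (extend_increment g dB) preimage_setI -incrE.
  rewrite setIA determined_increment_independent; last first.
    apply: determinedI; last exact: determined_shift.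
    exact: determined_le (leq_addr _ _) dA.
  by rewrite IH// -muleA -(determined_increment_independent _ dE).
rewrite (eq_esum (fun g _ => step g)).
rewrite -(@fineK _ (P A)) ?fin_num_measure//; last exact: mdet dA.
rewrite esumZl ?fine_ge0// fineK ?fin_num_measure//; last exact: mdet dA.
by rewrite -measure_esum_fibers.
Qed.

(** As functions of [B] both sides are finite measures, namely the image under [shift n] of [P]
    restricted to [A], and [P] scaled by [P A]. They agree on the pi-system of determined events. *)
Lemma markov_property_set n A B : determined n A -> measurable B ->
  P (A `&` shift n @^-1` B) = P A * P B.
Proof.
move=> dA mB; have mA := mdet dA.
have mth := measurable_shift countableG n.
have PAfin : P A \is a fin_num by exact: fin_num_measure.
pose k : {nonneg R} := NngNum (fine_ge0 (measure_ge0 P A)).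
rewrite setIC -[in RHS](fineK PAfin).
apply: (measure_unique [set A | exists p, determined p A] (fun=> setT)
  _ _ _ _ (pushforward (mrestr P mA) (shift n)) (mscale k P)).
- exact: measurable_paths_determined.
- move=> B1 B2 [p dB1] [q dB2]; exists (maxn p q).
  apply: determinedI; [apply: determined_le dB1|apply: determined_le dB2];
  by rewrite ?leq_maxl ?leq_maxr.
- by move=> _; exists 0%N.
- by apply/seteqP; split => // x _; exists 0%N.
- move=> B' [p dB']; change (P (shift n @^-1` B' `&` A) = (fine (P A))%:E * P B').
  by rewrite setIC fineK// (markov_property_determined dA dB').
- move=> _; change (P (setT `&` A) < +oo).
  by rewrite setTI -ge0_fin_numE.
- exact: mB.
Qed.

(** The equality of the two measures in [markov_property_set], integrated against [F] by change of
    variables. *)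
Lemma markov_property n A (F : paths G -> \bar R) : determined n A ->
  measurable_fun setT F -> (forall x, 0 <= F x) ->
  \int[P]_(x in A) F (shift n x) = P A * \int[P]_x F x.
Proof.
move=> dA mF F0; have mA := mdet dA.
have mth := measurable_shift countableG n.
have PAfin : P A \is a fin_num by exact: fin_num_measure.
pose k : {nonneg R} := NngNum (fine_ge0 (measure_ge0 P A)).
pose mA' : measurable (A : set (Measurable.sort (paths G))) := mA.
transitivity (\int[mrestr P mA']_x (F \o shift n) x).
  have mFs : measurable_fun setT (F \o shift n) by exact: measurableT_comp.
  have mCA := measurableC mA.
  rewrite -[in RHS](setUv A) (ge0_integral_setU _ mA mCA); last 3 first.
  - by rewrite setUv.
  - by move=> x _; exact: F0.
  - by apply/disj_setPS => x [].
  rewrite [X in _ + X]null_set_integral ?adde0//; last 2 first.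
  - exact: measurable_funTS.
  - by rewrite /= /mrestr setICl measure0.
  apply: eq_measure_integral => B mB BA.
  by rewrite /= /mrestr setIidl.
transitivity (\int[pushforward (mrestr P mA) (shift n)]_x F x).
  by rewrite ge0_integral_pushforward// preimage_setT.
rewrite -[in RHS](fineK PAfin) -[(fine (P A))%:E]/(k%:num%:E).
rewrite -ge0_integral_mscale//.
apply: eq_measure_integral => B mB _.
change (P (shift n @^-1` B `&` A) = (fine (P A))%:E * P B).
by rewrite setIC fineK// markov_property_set.
Qed.

Lemma random_walk_start_eq A B : measurable A -> measurable B ->
  (forall x, x 0%N = 1%g -> A x <-> B x) -> P A = P B.
Proof.
move=> mA mB AB; pose S := [set x : paths G | x 0%N = 1%g].
have PS : P S = 1.
  by apply: random_walk_start_ae => //; exact: (measurable_position 0 [set 1%g]).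
have dS : determined 0 S by exact: (@determined_position _ 0 [set 1%g]).
rewrite -[LHS]mul1e -[RHS]mul1e -PS -!determined0_independent//.
by congr (P _); apply/seteqP; split => x [Sx /(AB x Sx)].
Qed.

End markov_property.

(** * Entropy bounds from Gibbs' inequality *)

Section law.
Context {R : realType} {d} {T : measurableType d} (P : probability T R).
Context {I : choiceType} (countableI : countable [set: I]).
Variable Z : T -> I.
Hypothesis mZ : forall i, measurable (Z @^-1` [set i]).

Definition law (i : I) : R := fine (P (Z @^-1` [set i])).

Lemma law_ge0 i : (0 <= law i)%R. Proof. by rewrite fine_ge0. Qed.

Lemma lawE i : (law i)%:E = P (Z @^-1` [set i]).
Proof. by rewrite /law fineK// fin_num_measure. Qed.

Lemma law_le1 i : (law i <= 1)%R.
Proof. by rewrite -lee_fin lawE probability_le1. Qed.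

Lemma esum_law : \esum_(i in [set: I]) (law i)%:E = 1.
Proof.
rewrite -(probability_setT P) (measure_esum_fibers P countableI mZ)//.
by apply: eq_esum => i _; rewrite setTI lawE.
Qed.

Lemma measurable_preimage_fibers (B : set I) : measurable (Z @^-1` B).
Proof.
rewrite [X in measurable X](_ : _ =
    \bigcup_(i : I) (Z @^-1` [set i] `&` [set _ | B i])); last first.
  by apply/seteqP; split => [x Bx|x [i _ [/= <-]]//]; exists (Z x).
apply: countable_bigcupT_measurable => // i; apply: measurableI => //.
have [Bi|nBi] := pselect (B i).
  by rewrite (_ : [set _ | _] = setT)//; apply/seteqP; split.
by rewrite (_ : [set _ | _] = set0)//; apply/seteqP; split.
Qed.

Lemma measurable_fun_fibers d' (U : measurableType d') (f : I -> U) :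
  measurable_fun setT (f \o Z).
Proof.
by move=> _ B mB; rewrite setTI comp_preimage; exact: measurable_preimage_fibers.
Qed.

Lemma integral_law (f : I -> R) : (forall i, (0 <= f i)%R) ->
  \int[P]_x (f (Z x))%:E = \esum_(i in [set: I]) (f i * law i)%:E.
Proof.
move=> f0; rewrite (ge0_integral_esum_fibers P countableI mZ); last 2 first.
- by apply/measurable_EFinP; exact: measurable_fun_fibers.
- by move=> x; rewrite lee_fin.
apply: eq_esum => i _.
rewrite (eq_integral (cst (f i)%:E)); last by move=> x /[!inE] <-.
by rewrite integral_cst// EFinM lawE.
Qed.

(** The exceptional set is a countable union of null fibres. *)
Lemma law_gt0_ae : {ae P, forall x, (0 < law (Z x))%R}.
Proof.
exists (Z @^-1` [set i | law i = 0%R]); split.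
- exact: measurable_preimage_fibers.
- rewrite (measure_esum_fibers P countableI mZ); last first.
    exact: measurable_preimage_fibers.
  apply: esum1 => i _; have [i0|i0] := eqVneq (law i) 0%R.
    apply: (subset_measure0 _ (mZ i)) => //.
      by apply: measurableI => //; exact: measurable_preimage_fibers.
    by transitivity (law i)%:E; [exact/esym/lawE|rewrite i0].
  rewrite (_ : _ `&` _ = set0) ?measure0//; apply/seteqP; split => // x [/= + xi].
  by rewrite xi => /eqP; rewrite (negPf i0).
move=> x /= /negP; rewrite -leNgt => xle; apply/eqP.
by rewrite eq_le xle law_ge0.
Qed.

End law.

(** * Gibbs' inequality and the entropy of a product *)

Section entropy_bounds.
Context {R : realType} {d} {T : measurableType d} (P : probability T R).
Context {G : groupType} (countableG : countable [set: G]).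
Implicit Types (X Y Z : T -> G) (q : G -> R) (F : T -> \bar R).

Lemma entropy_term_ge0 (p : R) : (0 <= p <= 1)%R -> (0 <= - (p * ln p))%R.
Proof.
move=> /andP[p0 p1]; rewrite oppr_ge0 mulr_ge0_le0//.
exact: ln_le0.
Qed.

Lemma entropy_law_ge0 Z : (forall g, measurable (Z @^-1` [set g])) ->
  0 <= entropy (law P Z).
Proof.
move=> mZ; apply: esum_ge0 => g _.
by rewrite lee_fin entropy_term_ge0// law_ge0 law_le1.
Qed.

Lemma entropy_integral Z : (forall g, measurable (Z @^-1` [set g])) ->
  \int[P]_x (- ln (law P Z (Z x)))%:E = entropy (law P Z).
Proof.
move=> mZ; rewrite (integral_law P countableG mZ (f := fun g => (- ln (law P Z g))%R)).
  by apply: eq_esum => g _; rewrite mulNr mulrC.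
by move=> g; rewrite oppr_ge0 ln_le0// law_le1.
Qed.

(** This is [1 + t <= exp t] at [t = ln (q / p)], multiplied by [p] and arranged without a
    difference of masses. *)
Lemma gibbs_term (p q : R) : (0 < p)%R -> (0 < q)%R ->
  (- (p * ln p) + p <= p * - ln q + q)%R.
Proof.
move=> p0 q0; have := expR_ge1Dx (ln (q / p)).
rewrite lnK ?posrE ?divr_gt0// ln_div ?posrE//.
by rewrite ler_pdivlMr// => h; lra.
Qed.

(** Gibbs' inequality, with [F] dominating the code length of [Z]. Positivity of [q (Z x)] is
    demanded separately because [ln 0] is 0, so a value of zero mass would otherwise be coded for
    free. *)
Lemma entropy_le_code Z q F : (forall g, measurable (Z @^-1` [set g])) ->
  (forall g, (0 <= q g)%R) -> \esum_(g in [set: G]) (q g)%:E <= 1 ->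
  measurable_fun setT F -> (forall x, 0 <= F x) ->
  {ae P, forall x, (0 < q (Z x))%R /\ (- ln (q (Z x)))%:E <= F x} ->
  entropy (law P Z) <= \int[P]_x F x.
Proof.
(* The added 1 is the total mass of the law on the left and bounds that of [q] on the right, so
   [gibbs_term] can be summed term by term without subtraction. *)
move=> mZ q0 q1 mF F0 qF; rewrite -(@leeD2rE _ 1)//.
have qle1 g : (q g <= 1)%R.
  rewrite -lee_fin; apply: le_trans q1.
  by apply: (le_esum_term (a := fun g => (q g)%:E)) => h; rewrite lee_fin.
apply: le_trans (leeD2l _ q1).
rewrite -[in leLHS](esum_law P countableG mZ) /entropy -esumD; last 2 first.
- by move=> g _; rewrite lee_fin entropy_term_ge0// law_ge0 law_le1.
- by move=> g _; rewrite lee_fin law_ge0.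
rewrite (ge0_integral_esum_fibers P countableG mZ)// -esumD; last 2 first.
- by move=> g _; exact: integral_ge0.
- by move=> g _; rewrite lee_fin.
apply: le_esum => g _; rewrite -EFinD.
have [pg0|pg0] := eqVneq (law P Z g) 0%R.
  rewrite pg0 mul0r oppr0 addr0 adde_ge0//; first exact: integral_ge0.
  by rewrite lee_fin.
have pg : (0 < law P Z g)%R by rewrite lt_neqAle eq_sym pg0 law_ge0.
have qg : (0 < q g)%R.
  rewrite lt_neqAle q0 andbT eq_sym; apply/negP => /eqP qg0.
  case: qF => N [mN N0 ZN]; move/eqP: pg0; apply.
  rewrite /law (subset_measure0 (mZ g) mN _ N0)// => x /= xg.
  by apply: ZN => /= -[]; rewrite xg qg0 ltxx.
apply: (@le_trans _ _ ((law P Z g * - ln (q g))%:E + (q g)%:E)).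
  by rewrite -EFinD lee_fin gibbs_term.
apply: leeD2r; rewrite mulrC EFinM lawE// -integral_cst//.
apply: ae_ge0_le_integral => //.
- by move=> x _; rewrite lee_fin oppr_ge0 ln_le0.
- exact: measurable_funTS.
- by apply: filterS qF => x [_ qFx] /= xg; rewrite -xg.
Qed.

Lemma esum_translate q (h : G) : (forall g, (0 <= q g)%R) ->
  \esum_(g in [set: G]) (q (h^-1 * g)%g)%:E = \esum_(g in [set: G]) (q g)%:E.
Proof.
move=> q0; rewrite [RHS](reindex_esum [set: G] _ (fun g => (h^-1 * g)%g))//.
split => // [g1 g2 _ _ /mulgI//|g _].
by exists (h * g)%g => //; rewrite mulKg.
Qed.

Lemma esum_convolution_le1 (p q : G -> R) :
  (forall g, (0 <= p g)%R) -> (forall g, (0 <= q g)%R) ->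
  \esum_(g in [set: G]) (p g)%:E <= 1 -> \esum_(g in [set: G]) (q g)%:E <= 1 ->
  \esum_(g in [set: G]) \esum_(h in [set: G]) (p h * q (h^-1 * g)%g)%:E <= 1.
Proof.
move=> p0 q0 p1 q1; rewrite exchange_esum; last first.
  by move=> g h; rewrite lee_fin mulr_ge0.
apply: le_trans p1; apply: le_esum => h _.
under eq_esum do rewrite EFinM.
rewrite esumZl//; last by move=> g; rewrite lee_fin.
rewrite esum_translate//.
by rewrite -[leRHS]mule1; apply: lee_wpmul2l => //; rewrite lee_fin.
Qed.

(** [convolution] takes [fine] of a sum, which would send an infinite sum to 0; the bounds on total
    mass exclude that case. *)
Lemma convolution_fin (p q : G -> R) (g : G) :
  (forall g, (0 <= p g)%R) -> (forall g, (0 <= q g)%R) ->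
  \esum_(g in [set: G]) (p g)%:E <= 1 -> \esum_(g in [set: G]) (q g)%:E <= 1 ->
  (convolution p q g)%:E =
  \esum_(h in [set: G]) (p h * q (h^-1 * g)%g)%:E.
Proof.
move=> p0 q0 p1 q1; rewrite fineK// ge0_fin_numE; last first.
  by apply: esum_ge0 => h _; rewrite lee_fin mulr_ge0.
apply: (@le_lt_trans _ _ 1); last exact: ltey.
apply: le_trans (esum_convolution_le1 p0 q0 p1 q1).
apply: (le_esum_term (a := fun g => \esum_(h in [set: G]) (p h * q (h^-1 * g)%g)%:E)).
by move=> j; apply: esum_ge0 => h _; rewrite lee_fin mulr_ge0.
Qed.

Lemma convolution_ge0 (p q : G -> R) (g : G) :
  (forall g, (0 <= p g)%R) -> (forall g, (0 <= q g)%R) ->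
  (0 <= convolution p q g)%R.
Proof.
by move=> p0 q0; rewrite fine_ge0// esum_ge0// => h _; rewrite lee_fin mulr_ge0.
Qed.

Lemma convolution_ge (p q : G -> R) (g h : G) :
  (forall g, (0 <= p g)%R) -> (forall g, (0 <= q g)%R) ->
  \esum_(g in [set: G]) (p g)%:E <= 1 -> \esum_(g in [set: G]) (q g)%:E <= 1 ->
  (p h * q (h^-1 * g)%g <= convolution p q g)%R.
Proof.
move=> p0 q0 p1 q1; rewrite -lee_fin convolution_fin//.
apply: (le_esum_term (a := fun h => (p h * q (h^-1 * g)%g)%:E)).
by move=> j; rewrite lee_fin mulr_ge0.
Qed.

(** The convolution of the law of [Y] with [q] is used to code [X]. Keeping only the term of the
    convolution at [Y x] bounds the code length by [- ln (law P Y (Y x))], of mean H(Y), plus the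
    cost of the displacement from [Y x] to [X x]. *)
Lemma entropy_le_add X Y q F :
  (forall g, measurable (X @^-1` [set g])) ->
  (forall g, measurable (Y @^-1` [set g])) ->
  (forall g, (0 <= q g)%R) -> \esum_(g in [set: G]) (q g)%:E <= 1 ->
  measurable_fun setT F -> (forall x, 0 <= F x) ->
  {ae P, forall x, (0 < q ((Y x)^-1 * X x)%g)%R /\
                   (- ln (q ((Y x)^-1 * X x)%g))%:E <= F x} ->
  entropy (law P X) <= entropy (law P Y) + \int[P]_x F x.
Proof.
move=> mX mY q0 q1 mF F0 qF.
have pY0 := law_ge0 P Y; have pY1 : \esum_(g in [set: G]) (law P Y g)%:E <= 1.
  by rewrite esum_law.
have mlnY : measurable_fun setT (fun x => (- ln (law P Y (Y x)))%:E).
  apply/measurable_EFinP.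
  exact: (measurable_fun_fibers countableG mY (fun g => - ln (law P Y g))%R).
have lnY0 x : 0 <= (- ln (law P Y (Y x)))%:E.
  by rewrite lee_fin oppr_ge0 ln_le0// law_le1.
rewrite -(entropy_integral mY) -ge0_integralD//.
apply: (@entropy_le_code X (convolution (law P Y) q)) => //.
- by move=> g; exact: convolution_ge0.
- under eq_esum do rewrite convolution_fin//.
  exact: esum_convolution_le1.
- exact: emeasurable_funD.
- by move=> x; rewrite adde_ge0.
apply: filterS2 (law_gt0_ae P countableG mY) qF => x pYx [qx qFx].
have qq := convolution_ge (X x) (Y x) pY0 q0 pY1 q1.
have c0 := lt_le_trans (mulr_gt0 pYx qx) qq.
split => //; apply: le_trans (leeD2l _ qFx).
by rewrite -EFinD lee_fin -opprD lerN2 -lnM ?posrE// ler_ln ?posrE// mulr_gt0.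
Qed.

End entropy_bounds.

(** * Iterated stopping times *)

Section stopping_times.
Context {G : groupType}.
Implicit Types (x y : paths G) (T : paths G -> option nat).

(** The value [s = 0] is included, since the iterate of order 0 is the constant time 0. *)
Definition stopping T := forall s, determined s [set x | T x = Some s].

(** The first occurrence is split off rather than the last, so that inductions apply the Markov
    property at the first time. *)
Fixpoint iter_time T (n : nat) x : option nat :=
  if n is n'.+1 then
    if T x is Some t then omap (addn t) (iter_time T n' (shift t x)) else None
  else Some 0%N.

(** The default value at [None] makes this a total map; it is harmless only when [None] has
    probability zero. *)
Definition position T x : G := if T x is Some s then x s else 1%g.

Lemma iter_timeSP T n x s : iter_time T n.+1 x = Some s <->
  exists2 t, (t <= s)%N & T x = Some t /\ iter_time T n (shift t x) = Some (s - t)%N.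
Proof.
rewrite /=; split.
  case: (T x) => // t; case E : iter_time => [r|]//= [<-].
  by exists t; rewrite ?leq_addr// addKn.
by move=> [t ts [-> ->]] /=; rewrite subnKC.
Qed.

Lemma iter_time_stopping T n : stopping T -> stopping (iter_time T n).
Proof.
move=> dT; elim: n => [|n IH] s x y xy; first by [].
move=> /iter_timeSP[t ts [Tx nx]]; apply/iter_timeSP; exists t => //; split.
  by apply: dT Tx => i it; apply: xy; exact: leq_trans it ts.
by apply: IH nx => i its; rewrite /shift !xy// -leq_subRL.
Qed.

Arguments iter_time_stopping [T] n.

Lemma iter_time_Some1 n x : iter_time (fun=> Some 1%N) n x = Some n.
Proof. by elim: n x => //= n IH x; rewrite IH. Qed.

Lemma iter_time1 T : iter_time T 1 = T.
Proof. by apply/funext => x /=; case: (T x) => //= t; rewrite addn0. Qed.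

Section measurability.
Hypothesis countableG : countable [set: G].

Lemma measurable_stopping T (o : option nat) : stopping T ->
  measurable (T @^-1` [set o]).
Proof.
move=> dT; case: o => [s|]; first exact: measurable_determined (dT s).
rewrite (_ : _ @^-1` _ = ~` \bigcup_s T @^-1` [set Some s]).
  apply: measurableC; apply: bigcupT_measurable => s.
  exact: measurable_determined (dT s).
apply/seteqP; split => x /=; first by move=> Tx [s _]; rewrite /preimage/= Tx.
by case E : (T x) => [s|]// h; exfalso; apply: h; exists s.
Qed.

Lemma measurable_position_fiber T (g : G) : stopping T ->
  measurable (position T @^-1` [set g]).
Proof.
move=> dT; rewrite (_ : _ @^-1` _ =
    \bigcup_s (T @^-1` [set Some s] `&` [set x | x s = g]) `|`
    (T @^-1` [set None] `&` [set _ | 1%g = g])); last first.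
  apply/seteqP; split => x; rewrite /position /preimage/=.
    by case E : (T x) => [s|] xg; [left; exists s|right].
  by move=> [[s _ [/= -> ->]]|[-> ->]].
apply: measurableU.
  apply: bigcupT_measurable => s; apply: measurableI.
    exact: measurable_stopping.
  exact: (measurable_position s [set g]).
apply: measurableI; first exact: measurable_stopping.
have [<-|n1g] := eqVneq 1%g g.
  by rewrite (_ : [set _ | _] = setT)//; apply/seteqP; split.
by rewrite (_ : [set _ | _] = set0)//; apply/seteqP; split => // ? /= /eqP;
  rewrite (negPf n1g).
Qed.

(** * Laws of the positions at iterated stopping times *)

Section law.
Context {R : realType}.
Variables (mu : probability (discrete G) R) (P : probability (paths G) R).
Hypothesis P_law : random_walk_law mu P.

Let countable_option_nat : countable [set: option nat].
Proof. exact: countableP. Qed.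

Definition ae_finite T := P (T @^-1` [set None]) = 0.

Lemma ae_finiteP T : stopping T ->
  {ae P, forall x, T x <> None} <-> ae_finite T.
Proof.
move=> dT; split => [[N [mN N0 TN]]|T0].
  apply: (subset_measure0 (measurable_stopping None dT) mN _ N0) => x Tx.
  by apply: TN => /= /(_ Tx).
exists (T @^-1` [set None]); split => //; first exact: measurable_stopping.
by move=> x /= /contrapT.
Qed.

Lemma stopped_massE T : stopping T -> ae_finite T ->
  stopped_mass P T = law P (position T).
Proof.
move=> dT T0; apply/funext => g; rewrite /stopped_mass /law; congr fine.
set E := [set x | _].
have mE : measurable E.
  rewrite (_ : E = \bigcup_s (T @^-1` [set Some s] `&` [set x | x s = g])).
    apply: bigcupT_measurable => s; apply: measurableI.
      exact: measurable_stopping.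
    exact: (measurable_position s [set g]).
  by apply/seteqP; split => x [s]; [exists s|move=> _ []; exists s].
rewrite (_ : position T @^-1` [set g] =
    E `|` (position T @^-1` [set g] `&` T @^-1` [set None])); last first.
  apply/seteqP; split => x.
    rewrite /E /position /preimage/=.
    by case E' : (T x) => [s|] xg; [left; exists s|right].
  by move=> [[s Tx xs]|[]//]; rewrite /position /preimage/= Tx.
have mN : measurable (position T @^-1` [set g] `&` T @^-1` [set None]).
  by apply: measurableI; [exact: measurable_position_fiber|exact: measurable_stopping].
rewrite measureU0//; apply: (subset_measure0 mN _ _ T0) => //.
exact: measurable_stopping.
Qed.

(** Sliced by the first time [t], failure means that the previous iterate fails along the shifted
    path, which is null by the Markov property and induction. *)
Lemma iter_time_ae_finite T n : stopping T -> ae_finite T ->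
  ae_finite (iter_time T n).
Proof.
move=> dT T0; elim: n => [|n IH].
  by rewrite /ae_finite (_ : _ @^-1` _ = set0)//; apply/seteqP; split.
have mS := measurable_stopping None (iter_time_stopping n.+1 dT).
have mN := measurable_stopping None (iter_time_stopping n dT).
have mT o := measurable_stopping o dT.
rewrite /ae_finite (measure_esum_fibers P countable_option_nat mT)//.
apply: esum1 => -[t|] _.
  transitivity (P (T @^-1` [set Some t] `&`
      shift t @^-1` (iter_time T n @^-1` [set None]))).
    congr (P _); apply/seteqP; split => x; rewrite /preimage/=.
      by move=> [+ Tx]; rewrite Tx; case: iter_time.
    by move=> [Tx]; rewrite Tx => ->.
  by rewrite (markov_property_set countableG P_law (dT t) mN) IH mule0.
by apply: (subset_measure0 _ (mT None)) => //; exact: measurableI.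
Qed.

Lemma position_iter_time T n x t : T x = Some t ->
  iter_time T n (shift t x) <> None ->
  position (iter_time T n.+1) x =
  (position T x * position (iter_time T n) (shift t x))%g.
Proof.
rewrite /position /= => ->; case: iter_time => [r|]//= _.
by rewrite /shift mulVKg.
Qed.

(** The strong Markov property, obtained by slicing first by the position [h] at time [T] and then
    by the value [t] of [T]: on each slice the Markov property at the fixed time [t] separates the
    two factors. *)
Lemma law_position_iter_timeS T n : stopping T -> ae_finite T ->
  law P (position (iter_time T n.+1)) =
  convolution (law P (position T)) (law P (position (iter_time T n))).
Proof.
move=> dT T0; apply/funext => g; rewrite /convolution [LHS]/law; congr fine.
have mX := measurable_position_fiber _ dT.
have mS h := measurable_position_fiber h (iter_time_stopping n.+1 dT).
have mn h := measurable_position_fiber h (iter_time_stopping n dT).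
have mN := measurable_stopping None (iter_time_stopping n dT).
have mT o := measurable_stopping o dT.
rewrite (measure_esum_fibers P countableG mX)//; apply: eq_esum => h _.
have fibers (C : set (paths G)) : measurable C ->
    P C = \esum_(o in [set: option nat]) P (C `&` T @^-1` [set o]).
  exact: measure_esum_fibers.
rewrite EFinM (lawE P mX) muleC; apply: etrans (fibers _ _) _.
  exact: measurableI.
transitivity (\esum_(o in [set: option nat])
    ((law P (position (iter_time T n)) (h^-1 * g)%g)%:E *
     P (position T @^-1` [set h] `&` T @^-1` [set o]))); last first.
  by rewrite esumZl ?law_ge0//; congr (_ * _); exact/esym/fibers.
apply: eq_esum => -[t|] _; last first.
  rewrite (subset_measure0 _ (mT None))//; last first.
    by apply: measurableI => //; exact: measurableI.
  rewrite (subset_measure0 _ (mT None) _ T0) ?mule0//.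
  exact: measurableI.
have mP : measurable (position T @^-1` [set h] `&` T @^-1` [set Some t]).
  exact: measurableI.
have dP : determined t (position T @^-1` [set h] `&` T @^-1` [set Some t]).
  move=> x y xy [+ Tx]; have Ty := dT t x y xy Tx.
  rewrite /position /preimage/= in Tx Ty *.
  by rewrite Tx Ty xy.
rewrite (lawE P mn) muleC -(markov_property_set countableG P_law dP (mn _)).
have mshift (C : set (paths G)) : measurable C -> measurable (shift t @^-1` C).
  by move=> mC; rewrite -[X in measurable X]setTI; exact: measurable_shift.
(* Where the later iterate never occurs, [position] takes its default value and the product formula
   may fail; this set is null. *)
apply: (eq_measure_off_null (N := setT `&` shift t @^-1`
    (iter_time T n @^-1` [set None]))).
- by do 2![apply: measurableI => //].
- by apply: measurableI => //; exact: mshift.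
- by rewrite setTI; exact: mshift.
- have dt : determined t (setT : set (paths G)) by [].
  apply: etrans (markov_property_set countableG P_law dt mN) _.
  by rewrite iter_time_ae_finite// mule0.
move=> x; rewrite setTI => nx.
have posx Tx := position_iter_time (T := T) Tx nx.
split => [[[xg xh] Tx]|[[xh Tx] /= xg]]; do ?split => //.
  by move: xg; rewrite /preimage/= posx// xh => <-; rewrite mulKg.
by rewrite /preimage/= posx// xg xh mulVKg.
Qed.

Lemma law_position_iter_time T n : stopping T -> ae_finite T ->
  law P (position (iter_time T n)) = convolution_power (law P (position T)) n.
Proof.
move=> dT T0; elim: n => [|n IH]; last by rewrite law_position_iter_timeS// IH.
apply/funext => g; rewrite /law /position /=.
have mx : measurable [set x : paths G | x 0%N = g].
  exact: (measurable_position 0 [set g]).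
have [->|ng1] := eqVneq g 1%g.
  rewrite -[RHS]/(fine 1); congr fine.
  apply: (random_walk_start_ae P_law) => //.
  exact: (measurable_position 0 [set 1%g]).
rewrite -[RHS]/(fine 0); congr fine.
transitivity (P set0); last exact: measure0.
apply: (random_walk_start_eq countableG P_law) => // x x0.
by split => //= xg; move: ng1; rewrite -xg /= x0 eqxx.
Qed.

(** The walk at fixed times is the special case of the stopping time constantly 1. *)
Lemma law_random_walk n :
  law P (fun x => x n) = convolution_power (mass mu) n.
Proof.
have d1 : stopping (fun _ : paths G => Some 1%N) by move=> s x y _.
have f1 : ae_finite (fun _ : paths G => Some 1%N).
  by rewrite /ae_finite (_ : _ @^-1` _ = set0)//; apply/seteqP; split.
have -> : mass mu = law P (position (fun=> Some 1%N)).
  apply/funext => g; rewrite /mass /law; congr fine.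
  have [_ /(_ 0%N [set g]) <- _] := P_law.
  apply: (random_walk_start_eq countableG P_law).
  - exact: measurable_increment.
  - exact: (measurable_position 1 [set g]).
  - by move=> x x0; rewrite /preimage /position/= /increment x0 invg1 mul1g.
rewrite -law_position_iter_time//; congr (law P _); apply/funext => x.
by rewrite /position iter_time_Some1.
Qed.

End law.
End measurability.
End stopping_times.

(** * A smoothed absolute value *)

Section huber.
Context {R : realType}.
Implicit Types (K x y : R).

Definition huber K x : R := (Num.sqrt (K ^+ 2 + x ^+ 2))%R.

(** The first bound is a second-order Taylor remainder and vanishes as [K] grows; the second is a
    Lipschitz bound and provides an integrable majorant. *)
Definition huber_error K y : R := (Num.min (y ^+ 2 / (2 * K)) (2 * `|y|))%R.

Lemma huber_ge0 K x : (0 <= huber K x)%R.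
Proof. exact: sqrtr_ge0. Qed.

Lemma huber_sqr K x : (huber K x ^+ 2 = K ^+ 2 + x ^+ 2)%R.
Proof. by rewrite sqr_sqrtr// addr_ge0 ?sqr_ge0. Qed.

Lemma huber_ge_norm K x : (`|x| <= huber K x)%R.
Proof.
by rewrite -sqrtr_sqr ler_wsqrtr// lerDr sqr_ge0.
Qed.

Lemma huber_ge K x : (0 <= K)%R -> (K <= huber K x)%R.
Proof.
move=> K0; rewrite -[leLHS]ger0_norm// -sqrtr_sqr.
by rewrite ler_wsqrtr// lerDl sqr_ge0.
Qed.

Lemma huber0 K : (0 <= K)%R -> huber K 0 = K.
Proof. by move=> K0; rewrite /huber expr0n/= addr0 sqrtr_sqr ger0_norm. Qed.

Lemma huber_error_ge0 K y : (0 < K)%R -> (0 <= huber_error K y)%R.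
Proof.
move=> K0; rewrite le_min; apply/andP; split.
  by rewrite divr_ge0 ?sqr_ge0// mulr_ge0// ltW.
by rewrite mulr_ge0.
Qed.

(** With A and B the values at [x] and [x + y], the quadratic error comes from [(B - A) ^ 2 >= 0]
    and [A >= K]. The linear error comes from [B <= A + |y|] and [|x / A| <= 1]. *)
Lemma huberD_le K x y : (0 < K)%R ->
  (huber K (x + y) <= huber K x + x / huber K x * y + huber_error K y)%R.
Proof.
move=> K0.
have A0 : (0 < huber K x)%R := lt_le_trans K0 (huber_ge x (ltW K0)).
have KA := huber_ge x (ltW K0).
have xA := huber_ge_norm K x.
have AE := huber_sqr K x; have BE := huber_sqr K (x + y).
have B0 := huber_ge0 K (x + y).
move: A0 KA xA AE BE B0; set A := huber K x; set B := huber K (x + y).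
move=> A0 KA xA AE BE B0.
rewrite /huber_error minEle; case: ifP => _.
  apply: (@le_trans _ _ (A + x / A * y + y ^+ 2 / (2 * A))%R); last first.
    rewrite lerD2l ler_wpM2l ?sqr_ge0// lef_pV2 ?posrE ?mulr_gt0//.
    by rewrite ler_pM2l.
  have -> : (A + x / A * y + y ^+ 2 / (2 * A) =
      (2 * A ^+ 2 + 2 * (x * y) + y ^+ 2) / (2 * A))%R.
    by field; rewrite gt_eqF.
  rewrite ler_pdivlMr ?mulr_gt0//.
  have : (0 <= (B - A) ^+ 2)%R by exact: sqr_ge0.
  nra.
have xyA : (- `|y| <= x / A * y)%R.
  have : (`|x / A * y| <= `|y|)%R.
    rewrite normrM ler_piMl// normrM normfV (gtr0_norm A0).
    by rewrite ler_pdivrMr// mul1r.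
  by rewrite ler_norml => /andP[].
have BAy : (B <= A + `|y|)%R.
  rewrite -(@ler_pXn2r _ 2) ?nnegrE ?addr_ge0 ?(ltW A0)//.
  have yy : (`|y| ^+ 2 = y ^+ 2)%R by rewrite real_normK// num_real.
  have xyAy : (x * y <= A * `|y|)%R.
    by apply: le_trans (ler_norm _) _; rewrite normrM ler_wpM2r.
  rewrite BE; have -> : ((A + `|y|) ^+ 2 = A ^+ 2 + 2 * (A * `|y|) + `|y| ^+ 2)%R by ring.
  have -> : ((x + y) ^+ 2 = x ^+ 2 + 2 * (x * y) + y ^+ 2)%R by ring.
  by rewrite AE yy; lra.
by lra.
Qed.

End huber.

(** * Mean growth of the smoothed absolute value *)

Section huber_mean.
Context {R : realType} {d} {T : measurableType d} (P : probability T R).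
Context {I : choiceType} (countableI : countable [set: I]).
Variable Z : T -> I.
Hypothesis mZ : forall i, measurable (Z @^-1` [set i]).
Variables (f : I -> R) (l : R).
Hypothesis f0 : forall i, (0 <= f i)%R.
Hypothesis mean_f : \int[P]_x (f (Z x))%:E = l%:E.

Let mE (h : I -> R) : measurable_fun setT (fun x => (h (Z x))%:E).
Proof.
by apply/measurable_EFinP; exact: measurable_fun_fibers.
Qed.

Let integral_cstP (r : R) : \int[P]_x (cst r%:E) x = r%:E.
Proof.
by rewrite integral_cst// [X in _ * X]probability_setT mule1.
Qed.

Let integral_affine (a b : R) (h : I -> R) : (0 <= a)%R -> (0 <= b)%R ->
  (forall i, (0 <= h i)%R) ->
  \int[P]_x (a + b * f (Z x) + h (Z x))%:E =
  (a + b * l)%:E + \int[P]_x (h (Z x))%:E.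
Proof.
move=> a0 b0 h0.
rewrite (eq_integral (fun x => (cst a%:E x + b%:E * (f (Z x))%:E) + (h (Z x))%:E)); last first.
  by move=> x _; rewrite !EFinD EFinM.
have mb : measurable_fun setT (fun x => b%:E * (f (Z x))%:E).
  exact: measurable_funeM.
have fZ0 x : 0 <= (f (Z x))%:E by rewrite lee_fin.
have hZ0 x : 0 <= (h (Z x))%:E by rewrite lee_fin.
have bf0 x : 0 <= b%:E * (f (Z x))%:E by rewrite mule_ge0.
have ca0 x : 0 <= cst a%:E x :> \bar R by rewrite lee_fin.
have mab : measurable_fun setT (fun x => cst a%:E x + b%:E * (f (Z x))%:E).
  exact: emeasurable_funD.
rewrite (ge0_integralD P measurableT _ mab _ (mE h))//; last first.
  by move=> x _; rewrite adde_ge0.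
rewrite (ge0_integralD P measurableT _ (measurable_cst _) _ mb)//.
rewrite integral_cstP (ge0_integralZl_EFin P measurableT _ (mE f))//.
by rewrite mean_f EFinD EFinM.
Qed.

Let l0 : (0 <= l)%R.
Proof. by rewrite -lee_fin -mean_f integral_ge0// => x _; rewrite lee_fin. Qed.

(* The linear term of [huberD_le] averages to zero; it is kept nonnegative by
   adding [f + l] to both sides before integrating. *)
Lemma huber_mean_le K z : (0 < K)%R ->
  \int[P]_x (huber K (z + (f (Z x) - l)))%:E <=
  (huber K z)%:E + \int[P]_x (huber_error K (f (Z x) - l))%:E.
Proof.
move=> K0; pose b := (z / huber K z)%R.
have A0 : (0 < huber K z)%R := lt_le_trans K0 (huber_ge z (ltW K0)).
have b1 : (`|b| <= 1)%R.
  rewrite /b normrM normfV (gtr0_norm A0) ler_pdivrMr// mul1r.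
  exact: huber_ge_norm.
have /andP[b1l b1r] : (-1 <= b <= 1)%R by rewrite -ler_norml.
have b0 : (0 <= 1 + b)%R by lra.
have a0 : (0 <= (1 + b) * l)%R by rewrite mulr_ge0.
have h0 i : (0 <= huber K (z + (f i - l)))%R by exact: huber_ge0.
have e0 i : (0 <= huber_error K (f i - l))%R by exact: huber_error_ge0.
have : \int[P]_x ((1 + b) * l + 1 * f (Z x) + huber K (z + (f (Z x) - l)))%:E <=
    \int[P]_x ((huber K z + l) + (1 + b) * f (Z x) + huber_error K (f (Z x) - l))%:E.
  apply: ge0_le_integral => //.
  - by move=> x _; rewrite lee_fin !addr_ge0// mul1r.
  - exact: (mE (fun i => (1 + b) * l + 1 * f i + huber K (z + (f i - l)))%R).
  - exact: (mE (fun i => huber K z + l + (1 + b) * f i + huber_error K (f i - l))%R).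
  move=> x _; rewrite lee_fin.
  have := huberD_le z (f (Z x) - l)%R K0; rewrite -/b => h; nra.
rewrite (integral_affine (h := fun i => huber K (z + (f i - l))))//.
rewrite (integral_affine (h := fun i => huber_error K (f i - l)))//; last first.
  by rewrite addr_ge0// ltW.
have -> : ((1 + b) * l + 1 * l = (1 + b) * l + l)%R by rewrite mul1r.
have -> : (huber K z + l + (1 + b) * l = ((1 + b) * l + l) + huber K z)%R by ring.
by rewrite [in leRHS]EFinD -addeA leeD2lE.
Qed.

(** Dominated convergence along [K = n + 1]: the quadratic bound gives pointwise convergence to 0,
    the linear one the majorant [2 f + 2 l]. *)
Lemma huber_error_mean_small (e : R) : (0 < e)%R ->
  exists2 K, (0 < K)%R & \int[P]_x (huber_error K (f (Z x) - l))%:E <= e%:E.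
Proof.
move=> e0.
have ig : P.-integrable setT (fun x => (2 * f (Z x) + 2 * l)%:E).
  apply/integrableP; split; first exact: (mE (fun i => 2 * f i + 2 * l)%R).
  under eq_integral.
    move=> x _; rewrite gee0_abs; last by rewrite lee_fin addr_ge0 ?mulr_ge0.
    rewrite (_ : 2 * f (Z x) + 2 * l = 2 * l + 2 * f (Z x) + 0)%R; last by ring.
    over.
  rewrite (integral_affine (h := fun=> 0%R))// ?mulr_ge0//.
  by rewrite integral0 adde0 ltry.
pose F n x := (huber_error n.+1%:R (f (Z x) - l))%:E.
have F0 n i : (0 <= huber_error n.+1%:R (f i - l))%R.
  by apply: huber_error_ge0; rewrite ltr0n.
have Fcvg x : F ^~ x @ \oo --> 0.
  apply: cvg_EFin; first exact: nearW.
  pose y := (f (Z x) - l)%R.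
  apply: (@squeeze_cvgr _ _ _ _ (cst 0%R) (fun n => y ^+ 2 / 2 * harmonic n)%R).
  - apply: nearW => n; rewrite /= F0/= /huber_error /harmonic ge_min.
    by rewrite invfM mulrA lexx.
  - exact: cvg_cst.
  - by rewrite -(mulr0 (y ^+ 2 / 2)%R); apply: cvgM; [exact: cvg_cst|exact: cvg_harmonic].
have Fdom x n : `|F n x| <= (2 * f (Z x) + 2 * l)%:E.
  rewrite gee0_abs ?lee_fin// /huber_error ge_min; apply/orP; right.
  rewrite -mulrDr ler_pM2l//; apply: le_trans (ler_normB _ _) _.
  by rewrite !ger0_norm.
have [_ _] := dominated_convergence measurableT
  (fun n => mE (fun i => huber_error n.+1%:R (f i - l))) (measurable_cst 0)
  (aeW P (fun x _ => Fcvg x)) ig (aeW P (fun x n _ => Fdom x n)).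
rewrite integral0 => /fine_cvgP[[N1 _ finF] /cvgr0Pnorm_lt /(_ e e0)[N2 _ smallF]].
pose n := maxn N1 N2.
have := finF n (leq_maxl _ _); have := smallF n (leq_maxr _ _).
rewrite /= => Fe Ffin; exists n.+1%:R; first by rewrite ltr0n.
rewrite -(fineK Ffin) lee_fin; apply: le_trans (ltW Fe); exact: ler_norm.
Qed.

End huber_mean.

(** * Mean deviation of the iterated stopping time *)

Section iter_time_deviation.
Context {R : realType} {G : groupType}.
Hypothesis countableG : countable [set: G].
Variables (mu : probability (discrete G) R) (P : probability (paths G) R).
Hypothesis P_law : random_walk_law mu P.
Variables (T : paths G -> option nat) (l : R).
Hypotheses (dT : stopping T) (T0 : ae_finite P T).
Hypothesis mean_T : time_expectation P T = l%:E.

Let countable_option_nat : countable [set: option nat].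
Proof. exact: countableP. Qed.

Let mT o : measurable (T @^-1` [set o]).
Proof. exact: measurable_stopping. Qed.

Let miter n o : measurable (iter_time T n @^-1` [set o]).
Proof. by apply: measurable_stopping => //; exact: iter_time_stopping. Qed.

(** Real-valued replacement for the integrand of [time_expectation], which is infinite at [None];
    the two agree almost everywhere. *)
Definition time_value (o : option nat) : R := if o is Some s then s%:R else 0%R.

Lemma time_value_ge0 o : (0 <= time_value o)%R.
Proof. by case: o => /=. Qed.

Lemma integral_time_value : \int[P]_x (time_value (T x))%:E = l%:E.
Proof.
rewrite -mean_T /time_expectation.
apply: ge0_ae_eq_integral => //.
- apply/measurable_EFinP.
  exact: (measurable_fun_fibers countable_option_nat mT time_value).
- exact: (measurable_fun_fibers countable_option_nat mT
    (fun o => if o is Some s then s%:R%:E else +oo : \bar R)).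
- by move=> x _; rewrite lee_fin time_value_ge0.
- by move=> x _; case: (T x) => // s; rewrite lee_fin.
have /(ae_finiteP countableG P dT) : ae_finite P T by [].
by apply: filterS => x Tx _; case: (T x) Tx.
Qed.

(** The offset [z] holds the deviation accumulated by the iterates already split off. *)
Let dev (K z : R) n (o : option nat) : R :=
  if o is Some k then huber K (z + (k%:R - n%:R * l)) else 0%R.

Let dev_ge0 K z n o : (0 <= dev K z n o)%R.
Proof. by case: o => // k; exact: huber_ge0. Qed.

Let mdev K z n : measurable_fun setT (fun x => (dev K z n (iter_time T n x))%:E).
Proof.
apply/measurable_EFinP.
exact: (measurable_fun_fibers countable_option_nat (miter n) (dev K z n)).
Qed.

(** Induction on [n] with [z] free. Given a first time [t], the Markov property leaves [n] iterates
    with offset [z + (t - l)]; averaging over [t] by [huber_mean_le] costs at most [c]. *)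
Let integral_dev_le (K c : R) n z : (0 < K)%R -> (0 <= c)%R ->
  \int[P]_x (huber_error K (time_value (T x) - l))%:E <= c%:E ->
  \int[P]_x (dev K z n (iter_time T n x))%:E <= (huber K z + n%:R * c)%:E.
Proof.
move=> K0 c0 error_le.
have huber_mean y := huber_mean_le countable_option_nat mT time_value_ge0
  integral_time_value y K0.
elim: n z => [|n IH] z.
  rewrite (eq_integral (cst (huber K z)%:E)); last first.
    by move=> x _ /=; rewrite mul0r subr0 addr0.
  by rewrite integral_cst// [X in _ * X]probability_setT mule1 mul0r addr0.
rewrite (ge0_integral_esum_fibers P countable_option_nat mT)//; last first.
  by move=> x; rewrite lee_fin.
apply: (@le_trans _ _ (\esum_(o in [set: option nat])
    ((huber K (z + (time_value o - l)) + n%:R * c) * law P T o)%:E)).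
  apply: le_esum => -[t|] _; last first.
    rewrite integral0_eq; last first.
      by move=> x /= Tx; rewrite Tx.
    by rewrite lee_fin mulr_ge0 ?law_ge0// addr_ge0 ?huber_ge0 ?mulr_ge0.
  (* If [k] more units of time follow [t], then t + k - (n + 1) l = (t - l) + (k - n l). *)
  rewrite (eq_integral (fun x =>
      (dev K (z + (t%:R - l)) n (iter_time T n (shift t x)))%:E)); last first.
    move=> x /[!inE] /= ->; case: iter_time => //= k.
    by rewrite natrD -[n.+1]addn1 natrD; congr (huber K _)%:E; ring.
  rewrite (markov_property countableG P_law (@dT t) (mdev K (z + (t%:R - l)) n)).
    rewrite EFinM muleC (lawE P mT); apply: lee_wpmul2r => //.
  by move=> x; rewrite lee_fin.
rewrite -(integral_law P countable_option_nat mT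
  (f := fun o => huber K (z + (time_value o - l)) + n%:R * c)%R); last first.
  by move=> o; rewrite addr_ge0 ?huber_ge0 ?mulr_ge0.
under eq_integral do rewrite EFinD.
rewrite ge0_integralD//; last 3 first.
- by move=> x _; rewrite lee_fin huber_ge0.
- apply/measurable_EFinP; exact: (measurable_fun_fibers countable_option_nat mT
    (fun o => huber K (z + (time_value o - l)))).
- by move=> x _; rewrite lee_fin mulr_ge0.
rewrite integral_cst// [X in _ * X]probability_setT mule1.
apply: (@le_trans _ _ ((huber K z)%:E + c%:E + (n%:R * c)%:E)).
  apply: leeD2r; apply: le_trans (huber_mean z) _; exact: leeD2l.
by rewrite -!EFinD lee_fin -[n.+1]addn1 natrD; lra.
Qed.

Definition time_deviation (N : paths G -> option nat) (a : R) : \bar R :=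
  \int[P]_x (if N x is Some k then `|k%:R - a|%R else 0%R)%:E.

(** [K] is taken so large that each iterate costs at most [e]. Starting from offset 0 leaves the
    constant [huber K 0 = K]. *)
Lemma iter_time_deviation_sublinear (e : R) : (0 < e)%R -> exists C : R,
  forall n, time_deviation (iter_time T n) (n%:R * l) <= (C + n%:R * e)%:E.
Proof.
move=> e0.
have [K K0 error_le] := huber_error_mean_small countable_option_nat mT
  time_value_ge0 integral_time_value e0.
exists K => n; rewrite -[in leRHS](huber0 (ltW K0)).
apply: le_trans (integral_dev_le n 0 K0 (ltW e0) error_le).
apply: ge0_le_integral => //.
- by move=> x _; case: iter_time => // k; rewrite lee_fin.
- apply/measurable_EFinP; exact: (measurable_fun_fibers countable_option_nat (miter n)
    (fun o => if o is Some k then `|k%:R - n%:R * l|%R else 0%R)).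
move=> x _; rewrite lee_fin /dev; case: iter_time => // k.
by rewrite add0r huber_ge_norm.
Qed.

End iter_time_deviation.

(** * Entropy at a stopping time and at a fixed time *)

Lemma window_series (R : realType) (a : nat -> \bar R) (lo hi : nat) :
  (forall i, 0 <= a i) ->
  \sum_(i <oo) (if (lo <= i < hi)%N then a i else 0) = \sum_(lo <= i < hi) a i.
Proof.
move=> a0; rewrite (nneseries_split 0 hi); last first.
  by move=> i _; case: ifP.
rewrite add0n eseries0 ?adde0; last first.
  by move=> i hii _; rewrite ltnNge hii andbF.
rewrite -big_mkcond/= [RHS](big_nat_widenl lo 0)// big_nat_cond [RHS]big_nat_cond.
by apply: eq_bigl => i; case: (ltnP i hi) => //=; rewrite andbT.
Qed.

Section displacement_cost.
Context {R : realType} {G : groupType}.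
Hypothesis countableG : countable [set: G].
Variables (mu : probability (discrete G) R) (P : probability (paths G) R).
Hypothesis P_law : random_walk_law mu P.
Variable h : R.
Hypothesis entropy_mu : entropy (mass mu) = h%:E.

Let walk n (x : paths G) : G := x n.

Let mwalk n g : measurable (walk n @^-1` [set g]).
Proof. exact: (measurable_position n [set g]). Qed.

Let mincr n g : measurable (increment n @^-1` [set g] : set (paths G)).
Proof. exact: measurable_increment. Qed.

Let law_increment n : law P (increment n) = mass mu.
Proof. by have [_ incr _] := P_law; apply/funext => g; rewrite /law incr. Qed.

Let mass_ge0 g : (0 <= mass mu g)%R.
Proof. by rewrite -(law_increment 0) law_ge0. Qed.

Let mass_le1 g : (mass mu g <= 1)%R.
Proof. by rewrite -(law_increment 0) law_le1. Qed.

Let esum_mass : \esum_(g in [set: G]) (mass mu g)%:E <= 1.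
Proof. by rewrite -(law_increment 0) esum_law. Qed.

Let law_walkS n : law P (walk n.+1) = convolution (mass mu) (law P (walk n)).
Proof.
rewrite (law_random_walk countableG P_law n.+1).
by rewrite [X in convolution _ X](law_random_walk countableG P_law n).
Qed.

Definition step_cost (g : G) : R := (- ln (mass mu g))%R.

Let step_cost_ge0 g : (0 <= step_cost g)%R.
Proof. by rewrite oppr_ge0 ln_le0. Qed.

(** Induction on [j]: in the convolution giving the law at time [j.+1], only the term of the
    increment actually made by [x] is kept. *)
Let walk_displacement_cost (x : paths G) (a j : nat) :
  (forall i, (0 < mass mu (increment i x))%R) ->
  (0 < law P (walk j) ((x a)^-1 * x (a + j)%N)%g)%R /\
  (- ln (law P (walk j) ((x a)^-1 * x (a + j)%N)%g) <=
     \sum_(a <= i < a + j) step_cost (increment i x))%R.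
Proof.
move=> incr_gt0; elim: j a => [|j IH] a.
  rewrite addn0 mulVg big_geq// /walk (law_random_walk countableG P_law 0).
  by rewrite /convolution_power/= eqxx ln1 oppr0.
have [pos le_cost] := IH a.+1.
have conv : (mass mu (increment a x) *
    law P (walk j) ((x a.+1)^-1 * x (a.+1 + j)%N)%g <=
    law P (walk j.+1) ((x a)^-1 * x (a + j.+1)%N)%g)%R.
  have := convolution_ge (p := mass mu) (q := law P (walk j))
    ((x a)^-1 * x (a + j.+1)%N)%g (increment a x) mass_ge0 (law_ge0 P (walk j))
    esum_mass _.
  rewrite law_walkS esum_law// => /(_ (lexx _)).
  by rewrite /increment invgM invgK -mulgA mulVKg addSnnS.
have conv_gt0 := mulr_gt0 (incr_gt0 a) pos.
split; first exact: lt_le_trans conv_gt0 conv.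
have alt : (a < a + j.+1)%N by rewrite addnS ltnS leq_addr.
rewrite (big_ltn alt).
apply: (@le_trans _ _ (step_cost (increment a x) +
  - ln (law P (walk j) ((x a.+1)^-1 * x (a.+1 + j)%N)%g))%R).
  rewrite /step_cost -opprD lerN2 -lnM ?posrE// ler_ln ?posrE//.
  exact: lt_le_trans conv_gt0 conv.
by rewrite lerD2l -addSnnS.
Qed.

(** Half the Green function of the walk at parameter 1/2. The weights sum to 1, so this one
    sub-probability serves for displacements of every duration. *)
Let green (g : G) : R :=
  fine (\esum_(k in [set: nat]) (1 / (2 ^ k.+1)%:R * law P (walk k) g)%:E).

Let weight_ge0 k : (0 <= 1 / (2 ^ k.+1)%:R :> R)%R.
Proof. by rewrite divr_ge0. Qed.

Let esum_green_le1 :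
  \esum_(g in [set: G]) \esum_(k in [set: nat])
    (1 / (2 ^ k.+1)%:R * law P (walk k) g)%:E <= 1.
Proof.
rewrite exchange_esum; last first.
  by move=> g k; rewrite lee_fin mulr_ge0 ?law_ge0.
apply: le_trans (epsilon_trick0 xpredT ler01).
rewrite nneseries_esumT//; apply: le_esum => k _.
under eq_esum do rewrite EFinM.
rewrite esumZl//; last by move=> g; rewrite lee_fin law_ge0.
by rewrite esum_law// mule1.
Qed.

Let greenE g : (green g)%:E = \esum_(k in [set: nat])
    (1 / (2 ^ k.+1)%:R * law P (walk k) g)%:E.
Proof.
have term0 g' : 0 <= \esum_(k in [set: nat])
    (1 / (2 ^ k.+1)%:R * law P (walk k) g')%:E.
  by apply: esum_ge0 => k _; rewrite lee_fin mulr_ge0 ?law_ge0.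
rewrite fineK// ge0_fin_numE//.
apply: (@le_lt_trans _ _ 1); last exact: ltey.
apply: le_trans esum_green_le1.
by apply: (le_esum_term (a := fun g => \esum_(k in [set: nat])
  (1 / (2 ^ k.+1)%:R * law P (walk k) g)%:E)).
Qed.

Let green_ge0 g : (0 <= green g)%R.
Proof.
by rewrite fine_ge0// esum_ge0// => k _; rewrite lee_fin mulr_ge0 ?law_ge0.
Qed.

Let esum_green : \esum_(g in [set: G]) (green g)%:E <= 1.
Proof. by rewrite (eq_esum (fun g _ => greenE g)). Qed.

Let green_ge k g : (1 / (2 ^ k.+1)%:R * law P (walk k) g <= green g)%R.
Proof.
rewrite -lee_fin greenE.
apply: (le_esum_term (a := fun k => (1 / (2 ^ k.+1)%:R * law P (walk k) g)%:E)).
by move=> i; rewrite lee_fin mulr_ge0 ?law_ge0.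
Qed.

(* Symmetrised so that it codes the displacement in both directions of time. *)
Let sgreen (g : G) : R := ((green g + green g^-1%g) / 2)%R.

Let sgreen_ge0 g : (0 <= sgreen g)%R.
Proof. by rewrite divr_ge0// addr_ge0. Qed.

Let sgreenV g : sgreen g^-1%g = sgreen g.
Proof. by rewrite /sgreen invgK addrC. Qed.

Let esum_sgreen : \esum_(g in [set: G]) (sgreen g)%:E <= 1.
Proof.
have -> : \esum_(g in [set: G]) (sgreen g)%:E =
    \esum_(g in [set: G]) (2^-1%:E * (green g)%:E + 2^-1%:E * (green g^-1%g)%:E).
  by apply: eq_esum => g _; rewrite -!EFinM -EFinD -mulrDr mulrC.
rewrite esumD; last 2 first.
- by move=> g _; rewrite mule_ge0 ?lee_fin.
- by move=> g _; rewrite mule_ge0 ?lee_fin.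
rewrite !esumZl ?invr_ge0//; last first.
  by move=> g; rewrite lee_fin.
rewrite -(reindex_esum [set: G] [set: G] (fun g => g^-1%g) (fun g => (green g)%:E)); last first.
  by split => // [g1 g2 _ _ /invg_inj//|g _]; exists g^-1%g => //; rewrite invgK.
rewrite -ge0_muleDl ?lee_fin ?invr_ge0// -EFinD.
have -> : (2^-1 + 2^-1 = 1 :> R)%R by lra.
by rewrite mul1e.
Qed.

(** By symmetry [a <= b]; put [j = b - a]. Keeping the term [j] of [green] gives weight 2^-(j+1),
    and symmetrising halves it. The cost (j + 2) ln 2 splits into 2 ln 2 and one ln 2 per
    increment. *)
Let displacement_cost_le (x : paths G) (a b : nat) :
  (forall i, (0 < mass mu (increment i x))%R) ->
  (0 < sgreen ((x a)^-1 * x b)%g)%R /\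
  (- ln (sgreen ((x a)^-1 * x b)%g) <= 2 * ln 2 +
     \sum_(minn a b <= i < maxn a b) (ln 2 + step_cost (increment i x)))%R.
Proof.
move=> incr_gt0; wlog ab : a b / (a <= b)%N => [hw|].
  have [ab|ba] := orP (leq_total a b); first exact: hw.
  have -> : ((x a)^-1 * x b = ((x b)^-1 * x a)^-1)%g by rewrite invgM invgK.
  by rewrite sgreenV minnC maxnC; exact: hw.
rewrite (minn_idPl ab) (maxn_idPr ab) -(subnKC ab); set j := (b - a)%N.
have [pos le_cost] := walk_displacement_cost a j incr_gt0.
set g := ((x a)^-1 * x (a + j)%N)%g in pos le_cost *.
have ge_g : (1 / (2 ^ j.+2)%:R * law P (walk j) g <= sgreen g)%R.
  rewrite /sgreen ler_pdivlMr//; apply: le_trans (_ : _ <= green g)%R _; last first.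
    by rewrite lerDl.
  apply: le_trans (green_ge j g); rewrite mulrAC ler_wpM2r ?law_ge0//.
  by rewrite (expnS 2 j.+1) natrM invfM; lra.
have w0 : (0 < 1 / (2 ^ j.+2)%:R :> R)%R by rewrite divr_gt0// ltr0n expn_gt0.
have g0 := mulr_gt0 w0 pos.
split; first exact: lt_le_trans g0 ge_g.
rewrite big_split/= big_const_nat iter_addr_0 addKn.
apply: (@le_trans _ _ (- ln (1 / (2 ^ j.+2)%:R * law P (walk j) g))%R).
  by rewrite lerN2 ler_ln ?posrE//; exact: lt_le_trans g0 ge_g.
rewrite lnM ?posrE// div1r lnV ?posrE ?ltr0n ?expn_gt0// natrX lnXn//.
have -> : (ln 2 *+ j.+2 = 2 * ln 2 + ln 2 *+ j :> R)%R.
  by rewrite -[j.+2]addn2 mulrnDr addrC mulr_natl.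
by rewrite opprD opprK addrA lerD2l.
Qed.

(** * Comparison of a stopping time with a fixed time *)

Section compare.
Variables (N : paths G -> option nat) (m : nat).
Hypotheses (dN : stopping N) (N0 : ae_finite P N).

Let mN o : measurable (N @^-1` [set o]).
Proof. exact: measurable_stopping. Qed.

Let early i : set (paths G) := [set x | exists2 k, (k <= i)%N & N x = Some k].

(** For finite [N] this is the event that [i] lies between [N] and [m], in whichever order they
    come. This form shows it to be determined at time [i]. *)
Let window i := if (i < m)%N then early i else ~` early i.

Let determined_window i : determined i (window i).
Proof.
have dE : determined i (early i).
  move=> x y xy [k ki Nx]; exists k => //.
  by apply: dN Nx => p pk; apply: xy; exact: leq_trans pk ki.
by rewrite /window; case: ifP => // _; exact: determinedC.
Qed.

Let mwindow i : measurable (window i).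
Proof. by apply: measurable_determined => //; exact: determined_window. Qed.

Let windowE x k i : N x = Some k ->
  (x \in window i) = (minn k m <= i < maxn k m)%N.
Proof.
move=> Nx.
have earlyE : early i x <-> (k <= i)%N.
  by split=> [[k' ki]|ki]; [rewrite Nx => -[->]|exists k].
apply/idP/idP => [/set_mem|].
  rewrite /window geq_min leq_max; case: (ltnP i m) => im.
    by move/earlyE => ->; rewrite orbT.
  by rewrite /setC/= orbT/= orbF ltnNge => h'; apply/negP => /earlyE.
rewrite geq_min leq_max => hi; apply/mem_set; rewrite /window.
move: hi; case: (ltnP i m) => im; first by rewrite orbF orbT andbT => /earlyE.
by rewrite orbT orbF/= ltnNge => /negP h' /earlyE.
Qed.

Let mpatch (F : paths G -> \bar R) i : measurable_fun setT F ->
  measurable_fun setT ((F \o shift i) \_ (window i)).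
Proof.
move=> mF; apply/(measurable_restrictT _ (mwindow i)); apply: measurable_funTS.
by apply: measurableT_comp => //; exact: measurable_shift.
Qed.

Let window_sum (F : paths G -> \bar R) (x : paths G) : \bar R :=
  \sum_(i <oo) ((F \o shift i) \_ (window i)) x.

Let window_sum_ge0 F x : (forall y, 0 <= F y) -> 0 <= window_sum F x.
Proof.
by move=> F0; apply: nneseries_ge0 => i _ _; apply: erestrict_ge0 => y _; exact: F0.
Qed.

Let window_sumE F x k : (forall y, 0 <= F y) -> N x = Some k ->
  window_sum F x = \sum_(minn k m <= i < maxn k m) F (shift i x).
Proof.
move=> F0 Nx; rewrite -window_series; last by move=> i; exact: F0.
by apply: eq_eseriesr => i _; rewrite /patch (windowE _ Nx).
Qed.

Let mwindow_sum F : measurable_fun setT F -> (forall x, 0 <= F x) ->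
  measurable_fun setT (window_sum F).
Proof.
move=> mF F0; apply: (@ge0_emeasurable_sum _ _ _ setT
    (fun i => (F \o shift i) \_ (window i)) xpredT).
- by move=> i x _ _; apply: erestrict_ge0 => y _; exact: F0.
- by move=> i _; exact: mpatch.
Qed.

(** Wald's identity: [window i] is determined at time [i], so the Markov property gives each term
    the mean [c * P (window i)]. *)
Let integral_window_sum F c : measurable_fun setT F -> (forall x, 0 <= F x) ->
  \int[P]_x F x = c%:E ->
  \int[P]_x window_sum F x = c%:E * \sum_(i <oo) P (window i).
Proof.
move=> mF F0 intF; rewrite integral_nneseries//; last 2 first.
- by move=> i; exact: mpatch.
- by move=> i x _; apply: erestrict_ge0 => y _; exact: F0.
rewrite -nneseriesZl//; apply: eq_eseriesr => i _; rewrite -integral_mkcond.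
rewrite (markov_property countableG P_law (@determined_window i) mF F0).
by rewrite intF muleC.
Qed.

Let integral_one : \int[P]_x (cst 1 x) = 1 :> \bar R.
Proof. by rewrite integral_cst// [X in _ * X]probability_setT mule1. Qed.

(** For [F = 1] the window sum counts the times between [N] and [m]. *)
Let time_deviation_window : time_deviation P N m%:R = \sum_(i <oo) P (window i).
Proof.
rewrite -[RHS]mul1e -(integral_window_sum _ _ integral_one)//.
apply: ge0_ae_eq_integral => //.
- apply/measurable_EFinP.
  exact: (measurable_fun_fibers (countableP [set: option nat]) mN
    (fun o => if o is Some k then `|k%:R - m%:R : R|%R else 0%R)).
- exact: mwindow_sum.
- by move=> x _; case: (N x) => // k; rewrite lee_fin.
- by move=> x _; exact: window_sum_ge0.
apply: filterS (proj2 (ae_finiteP countableG P dN) N0) => x.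
case E : (N x) => [k|]// _ _; rewrite (window_sumE _ E)//.
rewrite (eq_bigr (fun=> 1%:E))// sumEFin; congr EFin.
rewrite sumr_const_nat.
have [km|/ltnW mk] := leqP k m.
  by rewrite distrC -natrB// ger0_norm.
by rewrite -natrB// ger0_norm.
Qed.

Let one_step_cost (x : paths G) : \bar R :=
  (ln 2 + step_cost (increment 0 x))%:E.

Let one_step_cost_ge0 x : 0 <= one_step_cost x.
Proof. by rewrite lee_fin addr_ge0// ln_ge0// ler1n. Qed.

Let mone_step_cost : measurable_fun setT one_step_cost.
Proof.
apply/measurable_EFinP; exact: (measurable_fun_fibers countableG (mincr 0)
  (fun g => ln 2 + step_cost g)%R).
Qed.

Let integral_one_step_cost : \int[P]_x one_step_cost x = (ln 2 + h)%:E.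
Proof.
rewrite /one_step_cost; under eq_integral do rewrite EFinD.
have mc : measurable_fun setT (fun x : paths G => (step_cost (increment 0 x))%:E).
  apply/measurable_EFinP.
  exact: (measurable_fun_fibers countableG (mincr 0) step_cost).
rewrite ge0_integralD//; last 2 first.
- by move=> x _; rewrite lee_fin ln_ge0// ler1n.
- by move=> x _; rewrite lee_fin.
rewrite integral_cst// [X in _ * X]probability_setT mule1 EFinD; congr (_ + _).
rewrite -entropy_mu -(law_increment 0) -(entropy_integral P countableG (mincr 0)).
by rewrite law_increment.
Qed.

Let cost (x : paths G) : \bar R := (2 * ln 2)%:E + window_sum one_step_cost x.

Let ln2_ge0 : (0 <= 2 * ln 2 :> R)%R.
Proof. by rewrite mulr_ge0// ln_ge0// ler1n. Qed.

Let integral_cost : \int[P]_x cost x =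
  (2 * ln 2)%:E + (ln 2 + h)%:E * time_deviation P N m%:R.
Proof.
rewrite ge0_integralD//; last 2 first.
- by move=> x _; exact: window_sum_ge0.
- exact: mwindow_sum.
rewrite integral_cst// [X in _ * X]probability_setT mule1.
by rewrite time_deviation_window -(integral_window_sum _ _ integral_one_step_cost).
Qed.

Let incr_gt0_ae : {ae P, forall x, forall i, (0 < mass mu (increment i x))%R}.
Proof.
apply/ae_foralln => i; have := law_gt0_ae P countableG (mincr i).
by rewrite law_increment.
Qed.

Let cost_adequate x :
  (forall i, (0 < mass mu (increment i x))%R) -> N x <> None ->
  ((0 < sgreen ((x m)^-1 * position N x)%g)%R /\
   (- ln (sgreen ((x m)^-1 * position N x)%g))%:E <= cost x) /\
  ((0 < sgreen ((position N x)^-1 * x m)%g)%R /\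
   (- ln (sgreen ((position N x)^-1 * x m)%g))%:E <= cost x).
Proof.
move=> incr_gt0; case E : (N x) => [k|]// _.
have -> : position N x = x k by rewrite /position E.
have -> : cost x = (2 * ln 2 +
    \sum_(minn k m <= i < maxn k m) (ln 2 + step_cost (increment i x)))%:E.
  rewrite /cost (window_sumE one_step_cost_ge0 E) EFinD -sumEFin; congr (_ + _).
  apply: eq_bigr => i _; rewrite /one_step_cost /increment /shift.
  by rewrite addn0 mulVg invg1 mul1g addn1.
split; last exact: displacement_cost_le.
by rewrite minnC maxnC; exact: displacement_cost_le.
Qed.

Let N_ae := proj2 (ae_finiteP countableG P dN) N0.

(** The displacement from [x m] to the position at [N] is coded by [sgreen], and Wald's identity
    computes the mean cost. As [sgreen] is symmetric, the same cost serves the opposite comparison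
    below. *)
Lemma entropy_position_le :
  entropy (law P (position N)) <= entropy (law P (fun x => x m)) +
  ((2 * ln 2)%:E + (ln 2 + h)%:E * time_deviation P N m%:R).
Proof.
rewrite -integral_cost.
apply: (@entropy_le_add _ _ _ P _ countableG (position N) (walk m) sgreen) => //.
- by move=> g; exact: measurable_position_fiber.
- by apply: emeasurable_funD => //; exact: mwindow_sum.
- by move=> x; rewrite adde_ge0 ?lee_fin// window_sum_ge0.
by apply: filterS2 incr_gt0_ae N_ae => x incr_gt0 /(cost_adequate incr_gt0)[].
Qed.

Lemma entropy_position_ge :
  entropy (law P (fun x => x m)) <= entropy (law P (position N)) +
  ((2 * ln 2)%:E + (ln 2 + h)%:E * time_deviation P N m%:R).
Proof.
rewrite -integral_cost.
apply: (@entropy_le_add _ _ _ P _ countableG (walk m) (position N) sgreen) => //.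
- by move=> g; exact: measurable_position_fiber.
- by apply: emeasurable_funD => //; exact: mwindow_sum.
- by move=> x; rewrite adde_ge0 ?lee_fin// window_sum_ge0.
by apply: filterS2 incr_gt0_ae N_ae => x incr_gt0 /(cost_adequate incr_gt0)[].
Qed.

End compare.
End displacement_cost.

(** * Fekete's lemma *)

Section sublinear_sequences.
Context {R : realType}.
Implicit Types (a b : nat -> R).

(** Applied with [e / 2], the constant [C] is absorbed once [n] exceeds [2 |C| / e]. *)
Lemma sublinear_cvg0 b :
  (forall e : R, (0 < e)%R -> exists C : R, forall n, (`|b n| <= C + n%:R * e)%R) ->
  (b n / n%:R)%R @[n --> \oo] --> (0 : R)%R.
Proof.
move=> bC; apply/cvgr0Pnorm_le => e e0.
have e20 : (0 < e / 2)%R by rewrite divr_gt0.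
have [C hC] := bC _ e20.
have [N _ HN] := nbhs_infty_gtr (2 * `|C| / e)%R.
exists N => // n /HN /= Cn.
have n0 : (0 < n%:R :> R)%R.
  by apply: le_lt_trans Cn; rewrite divr_ge0 ?(ltW e0)// mulr_ge0.
rewrite normrM normfV (gtr0_norm n0) ler_pdivrMr//.
apply: le_trans (hC n) _; move: Cn; rewrite ltr_pdivrMr// => Cn.
have := ler_norm C; nra.
Qed.

Lemma subadditive_le a (p q r : nat) :
  (forall m n, (a (m + n)%N <= a m + a n)%R) ->
  (a (q * p + r)%N <= q%:R * a p + a r)%R.
Proof.
move=> asub; elim: q => [|q IH]; first by rewrite mul0n add0n mul0r add0r.
rewrite mulSn -addnA; apply: le_trans (asub _ _) _.
by rewrite -[q.+1]addn1 natrD mulrDl mul1r; lra.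
Qed.

Lemma subadditive_cvg a : (forall n, (0 <= a n)%R) ->
  (forall m n, (a (m + n)%N <= a m + a n)%R) ->
  exists L : R, (a n / n%:R)%R @[n --> \oo] --> L.
Proof.
(* The limit is the infimum of the ratios; the index is moved by one to keep the ratio at 0 out of
   it. *)
move=> a0 asub; pose S := [set (a n.+1 / n.+1%:R)%R | n in [set: nat]].
have S0 : has_inf S.
  split; first by exists (a 1 / 1%:R)%R; exists 0%N.
  by exists 0%R => _ [n _ <-]; rewrite divr_ge0.
exists (inf S); apply/cvgrPdist_le => e e0.
have e20 : (0 < e / 2)%R by rewrite divr_gt0.
have [_ [p _ <-] ap] := inf_adherent e20 S0.
(* A common bound for [a r] over all remainders [r] modulo [p.+1]. *)
pose C := (\sum_(r < p.+1) a r)%R.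
have C0 : (0 <= C)%R by exact: sumr_ge0.
have [N _ HN] := nbhs_infty_gtr (2 * C / e)%R.
exists N => // n /HN /= Cn.
have n0 : (0 < n%:R :> R)%R.
  by apply: le_lt_trans Cn; rewrite divr_ge0 ?(ltW e0)// mulr_ge0.
have lb : (inf S <= a n / n%:R)%R.
  apply: ge_inf; first by case: S0.
  by exists n.-1 => //; rewrite prednK// -(ltr0n R).
rewrite distrC ger0_norm ?subr_ge0// lerBlDl ler_pdivrMr//.
pose q := (n %/ p.+1)%N; pose r := (n %% p.+1)%N.
have nqr : n = (q * p.+1 + r)%N by exact: divn_eq.
have ar : (a r <= C)%R.
  have rp : (r < p.+1)%N by rewrite ltn_mod.
  by rewrite /C (bigD1 (Ordinal rp))//= lerDl sumr_ge0.
have := subadditive_le p.+1 q r asub; rewrite -nqr => an.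
have p0 : (0 < p.+1%:R :> R)%R by rewrite ltr0n.
rewrite ltr_pdivrMr// in ap.
have nE : (n%:R = q%:R * p.+1%:R + r%:R :> R)%R by rewrite {1}nqr natrD natrM.
have q0 : (0 <= q%:R :> R)%R by [].
have r0 : (0 <= r%:R :> R)%R by [].
have lb0 : (0 <= inf S)%R.
  by apply: lb_le_inf; [case: S0|move=> _ [k _ <-]; rewrite divr_ge0].
have qap : (q%:R * a p.+1 <= q%:R * ((inf S + e / 2) * p.+1%:R))%R.
  by rewrite ler_wpM2l// ltW.
have sr0 : (0 <= (inf S + e / 2) * r%:R)%R.
  by rewrite mulr_ge0// addr_ge0// (ltW e20).
have qpE : (q%:R * ((inf S + e / 2) * p.+1%:R) =
    inf S * n%:R + e * n%:R / 2 - (inf S + e / 2) * r%:R)%R by rewrite nE; ring.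
rewrite mulrDl; move: qap Cn; rewrite qpE => qap; rewrite ltr_pdivrMr// => Cn.
lra.
Qed.

End sublinear_sequences.

(** * Asymptotic entropy *)

Section walk_entropy.
Context {R : realType} {G : groupType}.
Hypothesis countableG : countable [set: G].
Variables (mu : probability (discrete G) R) (P : probability (paths G) R).
Hypothesis P_law : random_walk_law mu P.

Let walk n (x : paths G) : G := x n.

Let mwalk n g : measurable (walk n @^-1` [set g]).
Proof. exact: (measurable_position n [set g]). Qed.

Let mshift m (A : set (paths G)) : measurable A -> measurable (shift m @^-1` A).
Proof.
by move=> mA; rewrite -[X in measurable X]setTI; exact: measurable_shift.
Qed.

Let law_displacement m n :
  law P (fun x => (x m)^-1 * x (m + n)%N)%g = law P (walk n).
Proof.
apply/funext => g; rewrite /law; congr fine.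
have dT : determined m (setT : set (paths G)) by [].
have := markov_property_set countableG P_law dT (mwalk n g).
by rewrite setTI probability_setT mul1e.
Qed.

(** The displacement between times [m] and [m + n] has the law of [x n]; coding it by that very law
    costs on average the entropy of [x n]. *)
Lemma walk_entropy_subadditive m n :
  entropy (law P (fun x => x (m + n)%N)) <=
  entropy (law P (fun x => x m)) + entropy (law P (fun x => x n)).
Proof.
pose Z (x : paths G) := ((x m)^-1 * x (m + n)%N)%g.
have mZ g : measurable (Z @^-1` [set g]) by exact: mshift (mwalk n g).
rewrite -[X in _ + entropy X](law_displacement m n).
rewrite -[X in _ + X](entropy_integral P countableG mZ).
apply: (@entropy_le_add _ _ _ P _ countableG (walk (m + n)) (walk m) (law P (walk n))) => //.
- by move=> g; exact: law_ge0.
- by rewrite esum_law.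
- apply/measurable_EFinP.
  exact: (measurable_fun_fibers countableG mZ (fun g => - ln (law P Z g))%R).
- by move=> x; rewrite lee_fin oppr_ge0 ln_le0// law_le1.
by apply: filterS (law_gt0_ae P countableG mZ) => x; rewrite law_displacement.
Qed.

Variable h : R.
Hypothesis entropy_mu : entropy (mass mu) = h%:E.

Let entropy_walk_ge0 n : 0 <= entropy (law P (walk n)).
Proof. exact: entropy_law_ge0. Qed.

Let law_walk1 : law P (walk 1) = mass mu.
Proof.
apply/funext => g; rewrite /mass /law; congr fine.
have [_ /(_ 0%N [set g]) <- _] := P_law.
apply: (random_walk_start_eq countableG P_law) => //.
  exact: measurable_increment.
by move=> x x0; rewrite /preimage/= /increment x0 invg1 mul1g.
Qed.

Lemma walk_entropy_fin n : entropy (law P (fun x => x n)) \is a fin_num.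
Proof.
rewrite ge0_fin_numE ?entropy_walk_ge0//; elim: n => [|n IH].
  rewrite [law _ _](law_random_walk countableG P_law 0) /entropy esum1 ?ltry//.
  move=> g _; rewrite /convolution_power/=.
  by case: eqP; rewrite ?ln1 ?mulr0 ?mul0r oppr0.
rewrite -[n.+1]addn1; apply: le_lt_trans (walk_entropy_subadditive n 1) _.
by rewrite lte_add_pinfty// law_walk1 entropy_mu ltry.
Qed.

(** [limn] alone does not assert convergence; the convergent real sequence is provided too, so that
    it can be composed with a change of time. *)
Lemma asymptotic_entropy_cvg : exists2 L : R,
  (fine (entropy (law P (fun x => x n))) / n%:R)%R @[n --> \oo] --> L &
  asymptotic_entropy (mass mu) = L%:E.
Proof.
have [L cvgL] : exists L : R,
    (fine (entropy (law P (walk n))) / n%:R)%R @[n --> \oo] --> L.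
  apply: (@subadditive_cvg _ (fun n => fine (entropy (law P (walk n))))) => [n|m n].
    by rewrite fine_ge0.
  by rewrite -lee_fin EFinD !fineK ?walk_entropy_fin// walk_entropy_subadditive.
exists L => //; apply/cvg_lim => //.
rewrite (_ : (fun n => _) =
    (fun n => (fine (entropy (law P (walk n))) / n%:R)%:E)); last first.
  apply/funext => n; rewrite -(law_random_walk countableG P_law n).
  by rewrite mulrC EFinM fineK// walk_entropy_fin.
by apply: cvg_EFin => //; exact: nearW.
Qed.

End walk_entropy.

(** Serves to move the centre of the deviation from [n l] to its integer part. *)
Lemma time_deviation_triangle (R : realType) (G : groupType)
    (countableG : countable [set: G]) (P : probability (paths G) R)
    (N : paths G -> option nat) (a b : R) : stopping N ->
  time_deviation P N b <= time_deviation P N a + `|a - b|%:E.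
Proof.
move=> dN.
have mE (c : R) : measurable_fun setT
    (fun x => (if N x is Some k then `|k%:R - c|%R else 0%R)%:E).
  apply/measurable_EFinP.
  exact: (measurable_fun_fibers (countableP [set: option nat])
    (fun o => measurable_stopping countableG o dN)
    (fun o => if o is Some k then `|k%:R - c|%R else 0%R)).
have E0 (c : R) x : 0 <= (if N x is Some k then `|k%:R - c|%R else 0%R)%:E.
  by case: (N x) => // k; rewrite lee_fin.
have -> : `|a - b|%:E = \int[P]_x (cst `|a - b|%:E x).
  by rewrite integral_cst// [X in _ * X]probability_setT mule1.
rewrite -ge0_integralD//; last by move=> x _; rewrite lee_fin.
apply: ge0_le_integral => //.
- by apply: emeasurable_funD => //; exact: measurable_cst.
move=> x _; rewrite -EFinD lee_fin; case: (N x) => [k|]; last by rewrite add0r.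
by rewrite (_ : k%:R - b = (k%:R - a) + (a - b))%R ?ler_normD//; ring.
Qed.

(** * Passage to the limit along the iterates of the stopping time *)

Theorem theorem2p4 (R : realType) (G : groupType)
  (countableG : countable [set: G])
  (mu : probability (discrete G) R)
  (finite_entropy : entropy (mass mu) < +oo)
  (P : probability (paths G) R)
  (P_law : random_walk_law mu P)
  (tau : paths G -> option nat)
  (tau_stopping : markov_stopping_time P tau)
  (finite_expectation : time_expectation P tau < +oo) :
  entropy (stopped_mass P tau) < +oo /\
  asymptotic_entropy (stopped_mass P tau) =
    time_expectation P tau * asymptotic_entropy (mass mu).
Proof.
have [_ tau_gt0 tau_ae tau_sigma] := tau_stopping.
have dtau : stopping tau.
  (* Measurability is given only for positive times; at time 0 the event is empty because [tau] is
     positive. *)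
  move=> [|s].
    rewrite (_ : [set _ | _] = set0) ?/determined//.
    by apply/seteqP; split => // x /= /tau_gt0.
  by apply: sigma_positions_determined; exact: tau_sigma.
have tau0 : ae_finite P tau by apply/(ae_finiteP countableG).
have mincr g : measurable (increment 0 @^-1` [set g] : set (paths G)).
  exact: measurable_increment.
have law_incr : law P (increment 0) = mass mu.
  by have [_ incr _] := P_law; apply/funext => g; rewrite /law incr.
have mu_fin : entropy (mass mu) \is a fin_num.
  by rewrite ge0_fin_numE// -law_incr entropy_law_ge0.
pose h := fine (entropy (mass mu)).
have hE : entropy (mass mu) = h%:E by rewrite fineK.
have h0 : (0 <= h)%R by rewrite fine_ge0// -law_incr entropy_law_ge0.
have tauE0 x : 0 <= (if tau x is Some s then s%:R%:E else +oo : \bar R).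
  by case: (tau x) => // s; rewrite lee_fin.
have mtauE : measurable_fun setT
    (fun x => if tau x is Some s then s%:R%:E else +oo : \bar R).
  exact: (measurable_fun_fibers (countableP [set: option nat])
    (fun o => measurable_stopping countableG o dtau)
    (fun o => if o is Some s then s%:R%:E else +oo : \bar R)).
have [l lE] : exists l : R, time_expectation P tau = l%:E.
  exists (fine (time_expectation P tau)); rewrite fineK// ge0_fin_numE//.
  exact: integral_ge0.
(* Besides [l > 0], this yields [n <= m n] below, so that [m n] tends to infinity and is nonzero for
   [n >= 1]. *)
have l1 : (1 <= l)%R.
  rewrite -lee_fin -lE.
  have <- : \int[P]_x (cst 1 x) = 1 :> \bar R.
    by rewrite integral_cst// [X in _ * X]probability_setT mule1.
  apply: ge0_le_integral => // x _ /=.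
  case E : (tau x) => [s|]; last exact: leey.
  by rewrite lee_fin ler1n; exact: tau_gt0 E.
have l0 : (0 < l)%R := lt_le_trans ltr01 l1.
rewrite (stopped_massE countableG dtau tau0).
have [L cvgL ->] := asymptotic_entropy_cvg countableG P_law hE.
pose T n := iter_time tau n.
have dT n : stopping (T n) by exact: iter_time_stopping.
have T0 n : ae_finite P (T n) by exact: (iter_time_ae_finite countableG P_law).
pose H n := entropy (law P (fun x => x n)).
have Hfin n : H n \is a fin_num by exact: (walk_entropy_fin countableG P_law hE).
pose K n := entropy (law P (position (T n))).
pose m n := Num.truncn (n%:R * l).
have m_itv n : ((m n)%:R <= n%:R * l < (m n).+1%:R)%R.
  by apply: truncn_itv; rewrite mulr_ge0// ltW.
have m_dist n : (`|n%:R * l - (m n)%:R| <= 1)%R.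
  have /andP[ml lm] := m_itv n; rewrite ger0_norm ?subr_ge0//.
  by move: lm; rewrite -addn1 natrD; lra.
have dev (e : R) : (0 < e)%R -> exists C : R, forall n,
    time_deviation P (T n) (m n)%:R <= (C + n%:R * e)%:E.
  move=> e0; have [C hC] :=
    iter_time_deviation_sublinear countableG P_law dtau tau0 lE e0.
  exists (C + 1)%R => n.
  apply: le_trans (time_deviation_triangle countableG P (n%:R * l)%R _ (dT n)) _.
  have -> : (C + 1 + n%:R * e)%:E = (C + n%:R * e)%:E + 1%:E.
    by rewrite -EFinD addrAC.
  by apply: leeD; [exact: hC|rewrite lee_fin].
pose D n := (2 * ln 2)%:E + (ln 2 + h)%:E * time_deviation P (T n) (m n)%:R.
have KH n : K n <= H (m n) + D n by exact: (entropy_position_le countableG P_law hE).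
have HK n : H (m n) <= K n + D n by exact: (entropy_position_ge countableG P_law hE).
have c0 : (0 < ln 2 + h)%R by rewrite ltr_pwDl// ln_gt0// ltr1n.
have D_le (e : R) : (0 < e)%R -> exists C : R, forall n, D n <= (C + n%:R * e)%:E.
  (* The rate [e / (ln 2 + h)] cancels the factor [ln 2 + h] in [D]. *)
  move=> e0; have [C hC] := dev _ (divr_gt0 e0 c0).
  exists (2 * ln 2 + (ln 2 + h) * C)%R => n.
  apply: (@le_trans _ _ ((2 * ln 2)%:E +
      (ln 2 + h)%:E * (C + n%:R * (e / (ln 2 + h)))%:E)).
    by apply: leeD2l; apply: lee_wpmul2l (hC n); rewrite lee_fin ltW.
  rewrite -EFinM -EFinD lee_fin mulrDr addrA le_eqVlt; apply/orP; left; apply/eqP; congr (_ + _)%R.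
  by field; rewrite gt_eqF.
have Kfin n : K n \is a fin_num.
  have [C hC] := D_le 1%R ltr01.
  rewrite ge0_fin_numE; last first.
    by apply: entropy_law_ge0 => g; exact: measurable_position_fiber.
  apply: le_lt_trans (KH n) _; rewrite lte_add_pinfty//.
    by rewrite ltey_eq Hfin.
  by apply: le_lt_trans (hC n) _; exact: ltry.
have KE n : entropy (convolution_power (law P (position tau)) n) = K n.
  by rewrite -(law_position_iter_time countableG P_law).
split.
  have := Kfin 1%N; rewrite /K /T iter_time1 ge0_fin_numE//.
  by apply: entropy_law_ge0 => g; exact: measurable_position_fiber.
rewrite lE -EFinM; apply/cvg_lim => //.
rewrite (_ : (fun n => _) = (fun n => (fine (K n) / n%:R)%:E)); last first.
  by apply/funext => n; rewrite KE mulrC EFinM fineK.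
apply: cvg_EFin; first exact: nearW.
have diff0 : ((fine (K n) - fine (H (m n))) / n%:R)%R @[n --> \oo] --> (0 : R)%R.
  apply: sublinear_cvg0 => e e0; have [C hC] := D_le e e0; exists C => n.
  have K_le : (fine (K n) <= fine (H (m n)) + (C + n%:R * e))%R.
    by rewrite -lee_fin EFinD !fineK//; apply: le_trans (KH n) _; exact: leeD2l.
  have H_le : (fine (H (m n)) <= fine (K n) + (C + n%:R * e))%R.
    by rewrite -lee_fin EFinD !fineK//; apply: le_trans (HK n) _; exact: leeD2l.
  by rewrite ler_norml; apply/andP; split; lra.
have ratio0 : (((m n)%:R - n%:R * l) / n%:R)%R @[n --> \oo] --> (0 : R)%R.
  apply: sublinear_cvg0 => e e0; exists 1%R => n.
  rewrite distrC; apply: le_trans (m_dist n) _.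
  by rewrite lerDl mulr_ge0// ltW.
have m_ge n : (n <= m n)%N.
  have /andP[_ lm] := m_itv n; rewrite -ltnS -(ltr_nat R).
  by apply: le_lt_trans lm; rewrite ler_peMr.
have m_oo : m n @[n --> \oo] --> \oo.
  by move=> A [N _ NA]; exists N => // n /= Nn; apply: NA; exact: leq_trans (m_ge n).
have HL : (fine (H (m n)) / (m n)%:R)%R @[n --> \oo] --> L.
  exact: (cvg_comp _ _ m_oo cvgL).
have ratio : ((m n)%:R / n%:R)%R @[n --> \oo] --> l.
  have : (((m n)%:R - n%:R * l) / n%:R + l)%R @[n --> \oo] --> (0 + l)%R.
    by apply: cvgD => //; exact: cvg_cst.
  rewrite add0r; apply: cvg_trans; apply: near_eq_cvg.
  exists 1%N => // n /= n1; have n0 : (n%:R != 0 :> R)%R by rewrite pnatr_eq0 -lt0n.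
  by rewrite mulrBl mulrAC divff// mul1r subrK.
(* For [n >= 1] this sum equals K_n / n; its parts tend to 0, to [L] and to [l]. *)
have : ((fine (K n) - fine (H (m n))) / n%:R +
    fine (H (m n)) / (m n)%:R * ((m n)%:R / n%:R))%R @[n --> \oo] --> (0 + L * l)%R.
  by apply: cvgD => //; apply: cvgM.
rewrite add0r mulrC; apply: cvg_trans; apply: near_eq_cvg.
exists 1%N => // n /= n1.
have n0 : (n%:R != 0 :> R)%R by rewrite pnatr_eq0 -lt0n.
have m0 : ((m n)%:R != 0 :> R)%R.
  by rewrite pnatr_eq0 -lt0n; exact: leq_trans (m_ge n).
by rewrite /=; field; rewrite n0 m0.
Qed.
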